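(* Let $d\geq 1$. For every even $n$, consider the complete graph $K_n$ whose edges $\{i,j\}$ are assigned lengths $l_{i,j}=(nX_{i,j})^{1/d}$, where the $X_{i,j}$ are independent exponential random variables with mean $1$, and let $M_n$ be the minimum total length of a perfect matching of $K_n$. Then there is a number $\beta_M(d)$ (depending only on $d$) such that $$\frac{M_n}{n}\to \beta_M(d)\quad\text{in probability as } n\to\infty \text{ (over even } n).$$
   Context: This random edge-length model on $K_n$ is called the pseudo-dimension $d$ mean field model. A perfect matching is a set of $n/2$ edges no two of which share a vertex. *)

(* Defs.v *)
From HB Require Import structures.
From mathcomp Require Import all_boot all_order all_algebra.
From mathcomp Require Import all_classical all_reals all_analysis.
Unset Strict Implicit. Unset Printing Implicit Defensive.
Import Order.TTheory GRing.Theory Num.Theory.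
Import numFieldNormedType.Exports.
Local Open Scope ring_scope.

Definition edge_index (n : nat) : finType := {p : 'I_n * 'I_n | (p.1 < p.2)%N}.

Definition perfect_matching (n : nat) (Mt : {set {set 'I_n}}) : Prop :=
  [/\ forall e, e \in Mt -> #|e| = 2%N,
      forall e f, e \in Mt -> f \in Mt -> e != f -> [disjoint e & f]
    & #|Mt| = n./2].

Local Open Scope classical_set_scope.

Definition mutually_independent {R : realType} {d} {T : measurableType d}
  (P : probability T R) {I : finType} (Y : I -> T -> R) : Prop :=
  forall (J : {set I}) (B : I -> set R), (forall i, measurable (B i)) ->
  P (\bigcap_(i in [set i | i \in J]) (Y i @^-1` B i)) =
  (\prod_(i in J) P (Y i @^-1` B i))%E.

Definition edge_length {R : realType} (d : R) (n : nat) (x : R) : R :=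
  powR (n%:R * x) d^-1.

(** Length of an edge e = {i,j} (written via the pair i < j in e). *)
Definition edge_len {R : realType} (d : R) (n : nat) (X : 'I_n -> 'I_n -> R)
  (e : {set 'I_n}) : R :=
  \sum_(i in e) \sum_(j in e | (i < j)%N) edge_length d n (X i j).

Definition matching_cost {R : realType} (d : R) (n : nat) (X : 'I_n -> 'I_n -> R)
  (Mt : {set {set 'I_n}}) : R :=
  \sum_(e in Mt) edge_len d n X e.

Definition min_matching {R : realType} (d : R) (n : nat) (X : 'I_n -> 'I_n -> R) : R :=
  inf [set c | exists Mt, perfect_matching n Mt /\ c = matching_cost d n X Mt].

(* Main.v *)
(** At truncation level t one maximises the total of (t - length)^+ over matchings,
    lengths being rounded up to a grid. If W(S) denotes the maximum on the vertex
    set S, the gains b(S,v) = W(S + v) - W(S) satisfy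
      b(S,v) = max_u (w(v,u) - b(S - u, u))^+,
    where the edges at v are independent of the gains on the right. Cutting this
    recursion at depth r bounds b from below (r even) or above (r odd), and the
    empirical law of the truncated values is within O(1/n) in mean square of a
    deterministic H_r, with H_(r+1) = exp (- K H_r) for a kernel K(i,j) = c(i + j).
    As K is symmetric, 1 - H_(r+1)(0) is, up to the mesh of the grid, a symmetric
    bilinear form in H_(r+1) and H_r; as H_(r+2) - H_r tends to 0, the even and
    the odd bound for the proportion of free vertices merge. Thus the number
    of vertices left free at level t is asymptotically deterministic for each t,
    and so is the truncated optimum, whose increment from level t to t + 1 is the
    number of edges used. Finally, a matching with 2x free vertices can be
    augmented by a path with at most three new edges of length O((n/x)^(3/4)); the
    sum of these costs over the few free vertices of a high level is a small
    multiple of n, so that the perfect optimum is close to the truncated one. *)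

From HB Require Import structures.
From mathcomp Require Import all_boot all_order all_algebra.
From mathcomp Require Import zify lra ring.
Import Order.TTheory GRing.Theory Num.Theory.
Set Implicit Arguments. Unset Strict Implicit. Unset Printing Implicit Defensive.

(** * Truncated maximum matchings and exploration *)

(** The even and odd iterates are compared only at the value 0: the balance identity controls this
    one value, and the proportion of free vertices is read off there. The price of the grid is that
    ties may occur, so the two bounds for the covered proportion at level t stay apart by about 2
    (g(0) - g(1)), which is twice (t dl)^d - ((t - 1) dl)^d for mesh dl. Summed over the levels up
    to theta = D dl, these errors telescope to 2 theta^d, and the sum is multiplied by dl, so it
    vanishes as dl tends to 0 with theta fixed. In return the grid makes the lengths finitely
    valued, so that the recursion is analysed under a finite product measure, and raising the level
    by one adds exactly one unit to every usable edge. The limit is not computed: each tolerance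
    yields an interval of that radius containing M_n / n with high probability, and these intervals
    have a common point. *)

Section Matchings.
Context {T : finType}.
Implicit Types (m : {set {set T}}) (S X Y : {set T}) (e : {set T}) (u v : T).

Definition matching m := [forall (e | e \in m), #|e| == 2] && trivIset m.

Lemma matching_card2 m e : matching m -> e \in m -> #|e| = 2.
Proof. by move=> /andP[/forall_inP h _] /h/eqP. Qed.

Lemma matching_triv m : matching m -> trivIset m.
Proof. by case/andP. Qed.

Lemma matching0 : matching set0.
Proof.
apply/andP; split; first by apply/forall_inP => e; rewrite inE.
by apply/trivIsetP => A B; rewrite inE.
Qed.

Lemma matching_sub m m' : m' \subset m -> matching m -> matching m'.
Proof.
move=> sub /andP[/forall_inP h t]; apply/andP; split; last exact: trivIsetS t.
by apply/forall_inP => e /(subsetP sub) /h.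
Qed.

Lemma mem_cover m e v : e \in m -> v \in e -> v \in cover m.
Proof. by move=> em ve; apply/bigcupP; exists e. Qed.

Lemma card_cover m : matching m -> #|cover m| = 2 * #|m|.
Proof.
move=> mm; have /eqP <- := matching_triv mm.
rewrite (eq_bigr (fun=> 2)) => [|e /(matching_card2 mm)//].
by rewrite sum_nat_const mulnC.
Qed.

Lemma card_matching_le m : matching m -> 2 * #|m| <= #|T|.
Proof. by move=> mm; rewrite -card_cover // max_card. Qed.

Lemma cards2_partner e v : #|e| = 2 -> v \in e ->
  exists2 u, u != v & e = [set v; u].
Proof.
move=> /eqP/cards2P[a [b [ab ->]]]; rewrite !inE => /orP[]/eqP->.
  by exists b; rewrite // eq_sym.
by exists a; rewrite // setUC.
Qed.

Lemma matching_add m u v : matching m -> u != v ->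
  u \notin cover m -> v \notin cover m -> matching ([set u; v] |: m).
Proof.
move=> mm uv um vm; apply/andP; split.
  apply/forall_inP => e; rewrite !inE => /orP[/eqP->|/(matching_card2 mm)->//].
  by rewrite cards2 uv.
have dis e : e \in m -> [disjoint [set u; v] & e].
  move=> em; rewrite -setI_eq0; apply/eqP/setP => x; rewrite !inE.
  apply/negbTE/negP => /andP[/orP[]/eqP-> xe].
    by move: um; rewrite (mem_cover em xe).
  by move: vm; rewrite (mem_cover em xe).
apply/trivIsetP => A B; rewrite !inE.
case/orP=> [/eqP->|Am]; case/orP=> [/eqP->|Bm] AB.
- by rewrite eqxx in AB.
- exact: dis.
- by rewrite disjoint_sym; exact: dis.
- exact: (trivIsetP (matching_triv mm)).
Qed.

Lemma notin_matching_add m u v : u \notin cover m -> [set u; v] \notin m.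
Proof.
move=> um; apply: contra um => em; apply: mem_cover em _.
by rewrite !inE eqxx.
Qed.

Lemma cover_add m u v : cover ([set u; v] |: m) = [set u; v] :|: cover m.
Proof. by rewrite /cover bigcup_setU big_set1. Qed.

Lemma cover_rem m e : matching m -> e \in m -> cover (m :\ e) = cover m :\: e.
Proof.
move=> mm em; apply/setP => x; rewrite inE; apply/bigcupP/andP.
  case=> f; rewrite !inE => /andP[fe fm] xf; split; last exact: mem_cover fm xf.
  have := trivIsetP (matching_triv mm) _ _ fm em fe.
  by move=> /disjoint_setI0/setP/(_ x); rewrite !inE xf /= => ->.
case=> xe /bigcupP[f fm xf]; exists f => //; rewrite !inE fm andbT.
by apply: contraNneq xe => <-.
Qed.

Section Weight.
Variable w : {set T} -> nat.

Definition maxW S := \max_(m | matching m && (cover m \subset S)) \sum_(e in m) w e.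

Lemma maxW_ge m S : matching m -> cover m \subset S -> \sum_(e in m) w e <= maxW S.
Proof. by move=> mm cS; apply: leq_bigmax_cond; rewrite mm. Qed.

Lemma maxW_ex S : exists m, [/\ matching m, cover m \subset S
  & \sum_(e in m) w e = maxW S].
Proof.
have h : 0 < #|[pred m | matching m && (cover m \subset S)]|.
  apply/card_gt0P; exists set0; rewrite inE matching0 /=.
  by rewrite /cover big_set0 sub0set.
have [m] := eq_bigmax_cond (fun m => \sum_(e in m) w e) h.
by rewrite inE => /andP[mm cS] e; exists m; split=> //; rewrite /maxW e.
Qed.

Lemma maxWS S S' : S \subset S' -> maxW S <= maxW S'.
Proof.
move=> sub; have [m [mm cS <-]] := maxW_ex S.
by apply: maxW_ge => //; apply: subset_trans sub.
Qed.

Definition gain S v := maxW (v |: S) - maxW S.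

Lemma maxW_add S u v : u \in S -> v \notin S ->
  w [set v; u] + maxW (S :\ u) <= maxW (v |: S).
Proof.
move=> uS vS; have [m [mm cS <-]] := maxW_ex (S :\ u).
have vu : v != u by apply: contraNneq vS => ->.
have um : u \notin cover m by apply/negP => /(subsetP cS); rewrite !inE eqxx.
have vm : v \notin cover m.
  by apply/negP => /(subsetP cS); rewrite !inE (negbTE vS) andbF.
rewrite -big_setU1 /=; last exact: notin_matching_add.
apply: maxW_ge; first exact: matching_add.
rewrite cover_add subUset; apply/andP; split.
  by apply/subsetP => x; rewrite !inE => /orP[]/eqP->; rewrite ?eqxx ?uS ?orbT.
apply: subset_trans cS _; apply/subsetP => x; rewrite !inE => /andP[_ ->].
by rewrite orbT.
Qed.

Lemma maxW_rem m e S : matching m -> cover m \subset S -> e \in m ->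
  \sum_(f in m) w f <= w e + maxW (S :\: e).
Proof.
move=> mm cS em; rewrite (big_setD1 e) //= leq_add2l; apply: maxW_ge.
  by apply: matching_sub mm; apply: subD1set.
by rewrite cover_rem //; apply: setSD.
Qed.

(** In an optimal matching of [v |: S] either [v] is free and the gain is 0, or it has a partner [u]
    and the rest lives in [S :\ u], whose optimum falls short of [maxW S] by [gain (S :\ u) u].
    Truncated subtraction supplies the positive part. *)
Lemma gain_rec S v : v \notin S ->
  gain S v = \max_(u in S) (w [set v; u] - gain (S :\ u) u).
Proof.
move=> vS; apply/eqP; rewrite eqn_leq; apply/andP; split; last first.
  apply/bigmax_leqP => u uS; rewrite /gain setD1K //.
  have := maxW_add uS vS; have := maxWS (subD1set S u); lia.
have [m [mm cS defW]] := maxW_ex (v |: S).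
have [/bigcupP[e em ve]|vm] := boolP (v \in cover m); last first.
  rewrite /gain (_ : _ - _ = 0) //; apply/eqP; rewrite subn_eq0 -defW.
  apply: maxW_ge => //; apply/subsetP => x xm.
  have := subsetP cS x xm; rewrite !inE => /orP[/eqP xv|//].
  by rewrite -xv xm in vm.
have [u uv defe] := cards2_partner (matching_card2 mm em) ve.
have uS : u \in S.
  have : u \in cover m by apply: mem_cover em _; rewrite defe !inE eqxx orbT.
  by move/(subsetP cS); rewrite !inE (negbTE uv).
have := maxW_rem mm cS em.
have -> : (v |: S) :\: e = S :\ u.
  apply/setP => x; rewrite defe !inE negb_or.
  by case: eqP => [->|] //=; rewrite (negbTE vS) andbF.
rewrite defW defe => h.
apply: leq_trans (leq_bigmax_cond _ uS); rewrite /gain setD1K //.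
have := maxWS (subD1set S u); lia.
Qed.

End Weight.

(** * Exploration to finite depth and the vertices covered by optimal matchings *)

Section Exploration.
Variable F : {set T} -> nat.

(* [gain_rec] cut off at depth r. The successor accounts for [excess] being
   F - 1: F = 0 marks an edge too long to be used, F = 1 one of weight 0. *)
Fixpoint explore r S v : nat :=
  if r is r'.+1 then \max_(u in S) (F [set v; u] - (explore r' (S :\ u) u).+1) else 0.

Definition excess e := (F e).-1.

(** Depth 0 is a lower bound because gains are nonnegative, and each unfolding of [gain_rec]
    subtracts the previous bound, which reverses the inequality. *)
Lemma explore_gain r S v : v \notin S ->
  if odd r then gain excess S v <= explore r S v else explore r S v <= gain excess S v.
Proof.
elim: r S v => [//|r IH] S v vS /=; rewrite gain_rec //=.
have step u : u \in S -> if odd r then gain excess (S :\ u) u <= explore r (S :\ u) u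
  else explore r (S :\ u) u <= gain excess (S :\ u) u.
  by move=> uS; apply: IH; rewrite !inE eqxx.
case: (odd r) step => /= step; apply/bigmax_leqP => u uS;
  apply: leq_trans (leq_bigmax_cond _ uS); have := step u uS; rewrite /excess; lia.
Qed.

(* For j > 0 this says that [explore] is below j, see [explore_leE]; j = 0 is the
   event that v has no profitable partner even when ties are broken in its favour. *)
Definition stuckb r j S v := [forall (u | u \in S), F [set v; u] <= j + explore r (S :\ u) u].

Lemma explore_leE r j S v : (explore r.+1 S v <= j) = stuckb r j.+1 S v.
Proof.
apply/bigmax_leqP/forall_inP => h u uS; move: (h u uS);
  rewrite -/(explore _ _ _) leq_subLR addnC addnS addSn //.
Qed.

(** [excess] does not separate F = 0 from F = 1; the last clause discards unusable edges, so that
    each edge of [m] gains a full unit when the level rises. *)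
Definition optimal m := [&& matching m, \sum_(e in m) excess e == maxW excess setT
  & [forall (e | e \in m), 0 < F e]].

Lemma optimal_ex : exists m, optimal m.
Proof.
have [m [mm _ defW]] := maxW_ex excess setT.
exists (m :&: [set e | 0 < F e]); apply/and3P; split.
- by apply: matching_sub mm; apply: subsetIl.
- rewrite -defW [X in _ == X](big_setID [set e | 0 < F e]) /=.
  rewrite [X in _ == _ + X]big1 ?addn0 //.
  by move=> e; rewrite !inE -leqNgt leqn0 => /andP[/eqP h _]; rewrite /excess h.
- by apply/forall_inP => e; rewrite !inE => /andP[].
Qed.

(** A vertex of positive gain is covered by every optimal matching: otherwise the optimum would be
    attained without it. *)
Lemma optimal_lower m r : optimal m -> ~~ odd r ->
  #|[set v | 0 < explore r (setT :\ v) v]| <= 2 * #|m|.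
Proof.
case/and3P=> mm /eqP defW _ rev; rewrite -card_cover //.
apply/subset_leq_card/subsetP => v; rewrite inE => b0.
have vT : v \notin [set: T] :\ v by rewrite !inE eqxx.
have := explore_gain r vT; rewrite (negbTE rev) => /(leq_trans b0).
apply: contraTT => vm; rewrite -leqNgt /gain setD1K ?inE // leqn0 subn_eq0 -defW.
apply: maxW_ge => //; apply/subsetP => x xm; rewrite !inE andbT.
by apply: contraNneq vm => <-.
Qed.

(** If [v] is matched to [u], optimality forces the gain of [u] in the graph without both to be at
    most the excess of their edge, hence below F; so this edge witnesses that [v] is not stuck. *)
Lemma optimal_upper m r : optimal m -> ~~ odd r ->
  2 * #|m| <= #|[set v | ~~ stuckb r 0 (setT :\ v) v]|.
Proof.
case/and3P=> mm /eqP defW /forall_inP pos rev; rewrite -card_cover //.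
apply/subset_leq_card/subsetP => v /bigcupP[e em ve]; rewrite inE.
have [u uv defe] := cards2_partner (matching_card2 mm em) ve.
apply/negP => /forall_inP/(_ u); rewrite !inE uv => /(_ isT).
rewrite add0n -defe leqNgt => /negP; apply.
have uT : u \notin [set: T] :\ v :\ u by rewrite !inE eqxx.
have := explore_gain r uT; rewrite (negbTE rev) => /leq_ltn_trans; apply.
have := maxW_rem excess mm (subsetT _) em; rewrite defW.
have -> : [set: T] :\: e = [set: T] :\ v :\ u.
  by apply/setP => x; rewrite defe !inE negb_or !andbT andbC.
rewrite /gain setD1K ?inE ?uv //.
have := maxWS excess (subD1set [set: T] v); have := pos e em; rewrite /excess; lia.
Qed.

End Exploration.
End Matchings.

(** The source of all independence below: exploring from [v] in [S] reads only edges inside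
    [v |: S]. *)
Lemma explore_local (T : finType) (F F' : {set T} -> nat) r (S : {set T}) v :
  {in v |: S &, forall x y, F [set x; y] = F' [set x; y]} ->
  explore F r S v = explore F' r S v.
Proof.
elim: r S v => [//|r IH] S v h /=; apply: eq_bigr => u uS; congr (_ - _.+1).
  by apply: h; rewrite !inE ?eqxx ?uS ?orbT.
have sub x : x \in u |: (S :\ u) -> x \in v |: S.
  by rewrite setD1K // !inE orbC => ->.
by apply: IH => x y /sub xS /sub yS; apply: h.
Qed.

Lemma subset_of_card (T : finType) (A : {set T}) k : k <= #|A| ->
  exists2 B : {set T}, B \subset A & #|B| = k.
Proof.
rewrite cardE => kA; exists [set x in take k (enum A)].
  by apply/subsetP => x; rewrite inE => /mem_take; rewrite mem_enum.
rewrite cardsE (card_uniqP _) ?size_takel //; exact/take_uniq/enum_uniq.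
Qed.

Lemma superset_of_card (T : finType) (A : {set T}) k : #|A| <= k -> k <= #|T| ->
  exists2 B : {set T}, A \subset B & #|B| = k.
Proof.
move=> Ak kT; have [|B BA cB] := @subset_of_card T (~: A) (#|T| - k).
  by rewrite cardsCs setCK; lia.
exists (~: B); first by rewrite subsetC.
by rewrite cardsCs setCK cB subKn.
Qed.

(** * Augmenting a matching in an expanding graph *)

Section AugmentCost.
Context {R : realDomainType}.
Local Open Scope ring_scope.

(** One inequality for each of the three augmentations in [augment]. *)
Lemma aug_cost1 (t a c : R) : 0 <= t -> a <= t -> a + c <= c + t *+ 3.
Proof. by move=> t0 at_; lra. Qed.

Lemma aug_cost2 (t a b c c' : R) : 0 <= t -> a <= t -> b <= t -> c <= c' ->
  a + (b + c) <= c' + t *+ 3.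
Proof. by move=> *; lra. Qed.

Lemma aug_cost3 (t a b p c c' c2 : R) : a <= t -> b <= t -> p <= t ->
  c <= c' -> c' <= c2 -> a + (b + (p + c)) <= c2 + t *+ 3.
Proof. by move=> *; lra. Qed.

End AugmentCost.

Section Augment.
Context {T : finType} {R : realDomainType}.
Implicit Types (m : {set {set T}}) (S X Y Z : {set T}) (e : {set T}) (u v : T).
Variable l : {set T} -> R.
Hypothesis l0 : forall e, (0 <= l e)%R.
Local Open Scope ring_scope.

Definition mcost m : R := \sum_(e in m) l e.

Lemma aug_add m u v : matching m -> u != v ->
  u \notin cover m -> v \notin cover m ->
  [/\ matching ([set u; v] |: m), #|[set u; v] |: m| = #|m|.+1
   & mcost ([set u; v] |: m) = l [set u; v] + mcost m].
Proof.
move=> mm uv um vm; have nm := notin_matching_add v um; split.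
- exact: matching_add.
- by rewrite cardsU1 nm.
- by rewrite /mcost big_setU1.
Qed.

Lemma aug_rem m e : matching m -> e \in m ->
  [/\ matching (m :\ e), #|m| = #|m :\ e|.+1 & mcost (m :\ e) <= mcost m].
Proof.
move=> mm em; split.
- by apply: matching_sub mm; apply: subD1set.
- by rewrite (cardsD1 e m) em.
- by rewrite /mcost [leRHS](big_setD1 e) //= lerDr.
Qed.

Variables (x y : nat) (lam : R).
(* The second clause is the form suited to a union bound of: x vertices have more
   than 2y neighbours at distance at most lam, see [card_nbh]. *)
Definition expanding :=
  [/\ (2 * y <= #|T|)%N,
   forall X Z, #|X| = x -> #|Z| = (2 * y)%N ->
    exists u v, [/\ u \in X, v \notin X :|: Z & l [set u; v] <= lam]
 & forall X Y, #|X| = y -> #|Y| = y -> [disjoint X & Y] ->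
    exists u v, [/\ u \in X, v \in Y & l [set u; v] <= lam]].

Definition nbh X := [set v | (v \notin X) && [exists (u | u \in X), l [set u; v] <= lam]].

Lemma nbhP X v : v \in nbh X -> v \notin X /\ exists2 u, u \in X & l [set u; v] <= lam.
Proof. by rewrite inE => /andP[vX /exists_inP]. Qed.

(** A neighbourhood that is too small could be enlarged to a set [Z] of size exactly 2y, and no
    close vertex would remain outside [X :|: Z]. *)
Lemma card_nbh X : expanding -> #|X| = x -> (2 * y < #|nbh X|)%N.
Proof.
case=> yT E1 _ cX; rewrite ltnNge; apply/negP => small.
have [Z NZ cZ] := superset_of_card small yT.
have [u [v [uX]]] := E1 X Z cX cZ; rewrite inE negb_or => /andP[vX vZ] lv.
by move/negP: vZ; apply; apply: (subsetP NZ); rewrite inE vX; apply/exists_inP; exists u.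
Qed.

Definition mate m v := odflt v [pick u | (u != v) && ([set v; u] \in m)].

Lemma mateP m v : matching m -> v \in cover m ->
  mate m v != v /\ [set v; mate m v] \in m.
Proof.
move=> mm /bigcupP[e em ve]; rewrite /mate; case: pickP => [u /andP[]//|h].
have [u uv defe] := cards2_partner (matching_card2 mm em) ve.
by have := h u; rewrite uv -defe em.
Qed.

Lemma matching_eq m e f v : matching m -> e \in m -> f \in m -> v \in e -> v \in f -> e = f.
Proof.
move=> mm em fm ve vf; apply: contraTeq isT => ef.
have := trivIsetP (matching_triv mm) _ _ em fm ef.
by move=> /disjoint_setI0/setP/(_ v); rewrite !inE ve vf.
Qed.

Lemma mateK m v : matching m -> v \in cover m -> mate m (mate m v) = v.
Proof.
move=> mm vm; have [nv em] := mateP mm vm.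
have wm : mate m v \in cover m by apply: mem_cover em _; rewrite !inE eqxx orbT.
have [nw fm] := mateP mm wm.
have := matching_eq mm em fm (set22 _ _) (set21 _ _) => /setP/(_ (mate m (mate m v))).
by rewrite !inE eqxx orbT (negbTE nw) orbF => /eqP.
Qed.

(* Split the 2x free vertices into two halves X1 and X2. Either two free vertices
   are close, or some matched pair is close to both halves, or the partners of the
   neighbours of X1 and of X2 contain a short edge b b'; the last case gives the
   augmenting path u - a = b - b' = a' - u'. *)
Lemma augment m : expanding -> matching m -> #|T| = (2 * (#|m| + x))%N ->
  exists m', [/\ matching m', #|m'| = #|m|.+1 & mcost m' <= mcost m + lam *+ 3].
Proof.
move=> ex mm cT; pose U := ~: cover m.
have cU : #|U| = (2 * x)%N by rewrite cardsCs setCK card_cover // cT; lia.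
have [|X1 X1U cX1] := @subset_of_card T U x; first by rewrite cU; lia.
pose X2 := U :\: X1.
have cX2 : #|X2| = x by rewrite cardsDS // cU cX1; lia.
have X2U : X2 \subset U by apply: subsetDl.
have notU v : (v \in U) = (v \notin cover m) by rewrite inE.
have N1 := card_nbh ex cX1; have N2 := card_nbh ex cX2.
have lam0 : 0 <= lam.
  have /card_gt0P[v /nbhP[_ [u _]]] : (0 < #|nbh X1|)%N by lia.
  exact: le_trans.
have [/existsP[u /existsP[v /and4P[uU vU uv luv]]]|/existsPn no1] :=
  boolP [exists u, exists v, [&& u \in U, v \in U, u != v & l [set u; v] <= lam]].
  rewrite !notU in uU vU.
  have [mm' cm' co'] := aug_add mm uv uU vU.
  by exists ([set u; v] |: m); split => //; rewrite co'; apply: aug_cost1.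
have NU X : X \subset U -> nbh X \subset cover m.
  move=> XU; apply/subsetP => v /nbhP[vX [u uX luv]].
  apply: contraT; rewrite -notU => vU; have /existsPn/(_ v) := no1 u.
  rewrite (subsetP XU) // vU luv andbT /= negbK => /eqP uv.
  by rewrite -uv uX in vX.
have {}NU1 := NU _ X1U; have {}NU2 := NU _ X2U.
have disjX u u' : u \in X1 -> u' \in X2 -> u != u'.
  by move=> u1; rewrite inE; apply: contraTneq => <-; rewrite u1.
have inU X u : X \subset U -> u \in X -> u \notin cover m.
  by move=> XU uX; rewrite -notU; apply: (subsetP XU).
have neqU u v : u \notin cover m -> v \in cover m -> u != v.
  by move=> um; apply: contraTneq => <-.
have [/exists_inP[a aN1 bN2]|no2] := boolP [exists a in nbh X1, mate m a \in nbh X2].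
  have am := subsetP NU1 _ aN1; have [ab em] := mateP mm am.
  have bm : mate m a \in cover m := subsetP NU2 _ bN2.
  have [_ [u u1 lua]] := nbhP aN1; have [_ [u' u2 lub]] := nbhP bN2.
  move: (mate m a) ab em bm bN2 lub => b ab em bm bN2 lub.
  have um := inU _ _ X1U u1; have um' := inU _ _ X2U u2.
  have [mm1 c1 co1] := aug_rem mm em; have cv1 := cover_rem mm em.
  have [||||mm2 c2 co2] := @aug_add (m :\ [set a; b]) u a.
  - by [].
  - exact: neqU.
  - by rewrite cv1 inE (negbTE um) andbF.
  - by rewrite cv1 !inE eqxx.
  have [||||mm3 c3 co3] := @aug_add ([set u; a] |: m :\ [set a; b]) u' b.
  - by [].
  - exact: neqU.
  - rewrite cover_add cv1 !inE (negbTE um') andbF orbF negb_or.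
    by rewrite eq_sym (disjX _ _ u1 u2) (neqU _ _ um' am).
  - by rewrite cover_add cv1 !inE (negbTE ab) eqxx orbT /= !orbF eq_sym (neqU _ _ um bm).
  exists ([set u'; b] |: ([set u; a] |: m :\ [set a; b])); split => //.
    by rewrite c3 c2 c1.
  by rewrite co3 co2; apply: aug_cost2.
have cmate X : X \subset cover m -> #|mate m @: X| = #|X|.
  move=> Xm; apply: card_in_imset => v v' /(subsetP Xm) vm /(subsetP Xm) vm' e.
  by rewrite -(mateK mm vm) e mateK.
have [|B1 B1s cB1] := @subset_of_card T (mate m @: nbh X1) y.
  by rewrite cmate //; lia.
(* Removing [B1] costs at most y elements; this is why neighbourhoods of size 2y are required. *)
have [|B2 B2s cB2] := @subset_of_card T (mate m @: nbh X2 :\: B1) y.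
  by rewrite cardsD cmate //; have := subset_leq_card (subsetIr (mate m @: nbh X2) B1); lia.
have dB : [disjoint B1 & B2].
  by rewrite -setI_eq0; apply/eqP/setP => v; rewrite !inE; apply/negP => /andP[v1];
    move/(subsetP B2s); rewrite inE v1.
have [_ _ E2] := ex; have [b [b' [b1 b2 lbb]]] := E2 _ _ cB1 cB2 dB.
have bb : b != b'.
  by apply: contraTneq b2 => <-; have := disjointFr dB b1 => ->.
have /imsetP[a aN1 defb] := subsetP B1s _ b1.
have /setDP[/imsetP[a' aN2 defb'] _] := subsetP B2s _ b2.
have am := subsetP NU1 _ aN1; have [ab em] := mateP mm am.
have am' := subsetP NU2 _ aN2; have [ab' em'] := mateP mm am'.
have bm : b \in cover m by rewrite defb; apply: mem_cover em _; rewrite !inE eqxx orbT.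
have bm' : b' \in cover m by rewrite defb'; apply: mem_cover em' _; rewrite !inE eqxx orbT.
have aa : a != a' by apply: contra_neq bb => aa; rewrite defb defb' aa.
have abN : a != b'.
  apply: contraNneq no2 => ab2; apply/exists_inP; exists a => //.
  by rewrite ab2 defb' mateK.
have baN : b != a'.
  by apply: contra_neq abN => ba; rewrite defb' -ba defb mateK.
have [_ [u u1 lua]] := nbhP aN1; have [_ [u' u2 lub]] := nbhP aN2.
have um := inU _ _ X1U u1; have um' := inU _ _ X2U u2; have uu := disjX _ _ u1 u2.
rewrite -defb in ab em; rewrite -defb' in ab' em'.
have [ua ub ua' ub'] : [/\ u != a, u != b, u != a' & u != b'] by split; exact: neqU.
have [va vb va' vb'] : [/\ u' != a, u' != b, u' != a' & u' != b'] by split; exact: neqU.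
have [mm1 c1 co1] := aug_rem mm em; have cv1 := cover_rem mm em.
have em1 : [set a'; b'] \in m :\ [set a; b].
  rewrite !inE em' andbT; apply/eqP => /setP/(_ a).
  by rewrite !inE eqxx (negbTE aa) (negbTE abN).
have [mm2 c2 co2] := aug_rem mm1 em1; have cv2 := cover_rem mm1 em1.
rewrite cv1 in cv2.
set m2 := m :\ _ :\ _ in mm2 c2 co2 cv2.
have [||||mm3 c3 co3] := @aug_add m2 u a => //.
- by rewrite cv2 !inE (negbTE um) !andbF.
- by rewrite cv2 !inE eqxx /= andbF.
have [||||mm4 c4 co4] := @aug_add ([set u; a] |: m2) b b' => //.
- by rewrite cover_add cv2 !inE eqxx orbT /= andbF orbF negb_or eq_sym ub.
- by rewrite cover_add cv2 !inE eqxx orbT /= orbF negb_or eq_sym ub' eq_sym.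
have [||||mm5 c5 co5] := @aug_add ([set b; b'] |: ([set u; a] |: m2)) u' a' => //.
- rewrite !cover_add cv2 !inE (negbTE um') !andbF orbF !negb_or.
  by rewrite vb vb' va eq_sym uu.
- rewrite !cover_add cv2 !inE eqxx /= orbF !negb_or.
  by rewrite !(eq_sym a') baN ab' ua' aa.
exists ([set u'; a'] |: ([set b; b'] |: ([set u; a] |: m2))); split => //.
  by rewrite c5 c4 c3 c1 c2.
by rewrite co5 co4 co3; apply: aug_cost3 co2 co1 => //; rewrite setUC.
Qed.

End Augment.

(** The radius [lam x] is used at the moment when 2x vertices are still free. *)
Lemma augment_perfect (T : finType) (R : realDomainType) (l : {set T} -> R)
    (y : nat -> nat) (lam : nat -> R) k m :
  (forall e, 0 <= l e)%R ->
  (forall x, 0 < x <= k -> expanding l x (y x) (lam x)) ->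
  matching m -> #|T| = 2 * (#|m| + k) ->
  exists m', [/\ matching m', 2 * #|m'| = #|T| &
    (mcost l m' <= mcost l m + \sum_(1 <= x < k.+1) lam x *+ 3)%R].
Proof.
move=> l0; elim: k m => [|k IH] m ex mm cT.
  by exists m; split => //; [lia | rewrite big_geq // addr0].
have hk : 0 < k.+1 <= k.+1 by rewrite leqnn.
have [m1 [mm1 c1 co1]] := augment l0 (ex _ hk) mm cT.
have exk x : 0 < x <= k -> expanding l x (y x) (lam x).
  by move=> /andP[x0 xk]; apply: ex; rewrite x0 ltnW.
have cT1 : #|T| = 2 * (#|m1| + k) by rewrite cT c1 addnS addSn.
have [m' [mm' c' co']] := IH m1 exk mm1 cT1.
exists m'; split => //; apply: (le_trans co').
by rewrite [in leRHS]big_nat_recr //= [leRHS]addrCA [leLHS]addrC lerD2l.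
Qed.

Require Import Defs.
From mathcomp Require Import all_classical all_reals all_analysis.
From mathcomp Require Import measurable_realfun.
Import numFieldNormedType.Exports.
Local Open Scope ring_scope.

(** * The limit recursion *)

Section LimitRecursion.
Context {R : realType}.
Variables (D : nat) (c : nat -> R).
Hypothesis c_ge0 : forall m, 0 <= c m.
Hypothesis c_noninc : forall m, c m.+1 <= c m.
Hypothesis c_eq0 : forall m, (D <= m)%N -> c m = 0.

(** The shift to [j.+1] mirrors [explore_leE]. In terms of [Klim] below, [Hlim r.+1 j] is
    [Klim r j.+1], while [Klim r 0] is the limit for the tie event [stuckb] with j = 0. *)
Fixpoint Hlim r j : R :=
  if r is r'.+1 then expR (- \sum_(i < D) c (i + j.+1) * Hlim r' i) else 1.

(* [Hlim r j] is the limiting proportion of vertices whose value explored to depth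
   r is at most j. *)
Definition Klim r j := expR (- \sum_(i < D) c (i + j) * Hlim r i).

Lemma HlimS r j : Hlim r.+1 j = expR (- \sum_(i < D) c (i + j.+1) * Hlim r i).
Proof. by []. Qed.

Lemma Hlim_gt0 r j : 0 < Hlim r j.
Proof. by case: r => [|r] /=; rewrite ?expR_gt0. Qed.

Arguments Hlim : simpl never.

Lemma Hlim_ge0 r j : 0 <= Hlim r j. Proof. exact/ltW/Hlim_gt0. Qed.

Lemma Hlim_le1 r j : Hlim r j <= 1.
Proof.
case: r => [//|r]; rewrite HlimS -[leRHS]expR0 ler_expR oppr_le0.
by apply: sumr_ge0 => i _; rewrite mulr_ge0 ?Hlim_ge0.
Qed.

(** The recursion reverses the order, and it starts from the largest possible function, the constant
    1. *)
Lemma Hlim_alt r j : if odd r then Hlim r j <= Hlim r.+2 j else Hlim r.+2 j <= Hlim r j.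
Proof.
elim: r j => [|r IH] j; first exact: Hlim_le1.
rewrite oddS (HlimS r.+2) (HlimS r) !ler_expR !lerN2.
by case: (odd r) IH => IH; apply: ler_sum => i _; rewrite ler_wpM2l.
Qed.

(** As [c] stands for the first differences of a function g, this is a second difference,
    nonnegative by convexity of g. *)
Let a m := c m.+1 - c m.+2.
Let a_ge0 m : 0 <= a m. Proof. by rewrite subr_ge0. Qed.

Lemma c_le0 m : c m <= c 0.
Proof. by elim: m => // m; apply: le_trans. Qed.

Lemma sum_c_le k : \sum_(i < D) (c (i + k) - c (i + k).+1) <= c 0.
Proof.
rewrite (eq_bigr (fun i : 'I_D => - (c (i.+1 + k) - c (i + k)))); last first.
  by move=> i _; rewrite opprB addSn.
rewrite sumrN -(big_mkord xpredT (fun i => c (i.+1 + k) - c (i + k))).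
rewrite telescope_sumr // opprB add0n [c (D + k)]c_eq0 ?leq_addr // subr0.
exact: c_le0.
Qed.

Let B (F G : nat -> R) := \sum_(j < D) \sum_(i < D) a (i + j) * F j * G i.

Let BC F G : B F G = B G F.
Proof.
rewrite /B exchange_big; apply: eq_bigr => i _; apply: eq_bigr => j _.
by rewrite addnC mulrAC.
Qed.

(** The kernel of [B] is the difference of the exponents at neighbouring arguments. The bound [c 0]
    on one step of log H is the mesh error of the later estimates. *)
Lemma Hlim_increment r j : let d := \sum_(i < D) a (i + j) * Hlim r i in
  [/\ 0 <= d, d <= c 0 & Hlim r.+1 j.+1 = Hlim r.+1 j * expR d].
Proof.
split.
- by apply: sumr_ge0 => i _; rewrite mulr_ge0 // Hlim_ge0.
- apply: le_trans (sum_c_le j.+1); apply: ler_sum => i _.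
  by rewrite addnS ler_piMr ?Hlim_le1.
- rewrite !HlimS -expRD -!sumrN -big_split; congr (expR _).
  by apply: eq_bigr => i _; rewrite /a !addnS /=; ring.
Qed.

(* B is symmetric because its kernel depends on i + j only, so the defect
   1 - Hlim r 0 is almost a symmetric function of two consecutive iterates. *)
Lemma Hlim_balance r :
  B (Hlim r.+1) (Hlim r) <= 1 - Hlim r.+1 0 <= B (Hlim r.+1) (Hlim r) + c 0.
Proof.
(* Boundary value: beyond [D] the kernel vanishes, so 1 - H(0) is a sum of increments. *)
have HD : Hlim r.+1 D = 1.
  rewrite HlimS big1 ?oppr0 ?expR0 // => i _.
  by rewrite c_eq0 ?mul0r // addnS ltnW // ltnS leq_addl.
have tel : 1 - Hlim r.+1 0 = \sum_(j < D) (Hlim r.+1 j.+1 - Hlim r.+1 j).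
  by rewrite -(big_mkord xpredT (fun j => Hlim r.+1 j.+1 - Hlim r.+1 j))
    telescope_sumr // HD.
have BE : B (Hlim r.+1) (Hlim r)
    = \sum_(j < D) Hlim r.+1 j * \sum_(i < D) a (i + j) * Hlim r i.
  apply: eq_bigr => j _; rewrite mulr_sumr; apply: eq_bigr => i _.
  by rewrite mulrCA mulrA.
rewrite tel BE; apply/andP; split.
  apply: ler_sum => j _; have [d0 _ ->] := Hlim_increment r j.
  set d := \sum_(i < D) _ in d0 *; have := expR_ge1Dx d; have := Hlim_gt0 r.+1 j.
  by move: (Hlim _ _) (expR d) => h e h0 ed; nra.
have H0 := Hlim_ge0 r.+1 0.
(* From e^d - 1 <= d e^d and d <= c 0 follows e^d - 1 <= d + c 0 (e^d - 1); weighted by H, the last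
   term telescopes to at most c 0. *)
apply: (@le_trans _ _ (\sum_(j < D) Hlim r.+1 j * (\sum_(i < D) a (i + j) * Hlim r i)
    + c 0 * \sum_(j < D) (Hlim r.+1 j.+1 - Hlim r.+1 j))); last first.
  rewrite lerD2l -tel ler_piMr // gerBl; exact: Hlim_ge0.
rewrite mulr_sumr -big_split; apply: ler_sum => j _ /=.
have [d0 dc ->] := Hlim_increment r j.
set d := \sum_(i < D) _ in d0 dc *.
have := expR_ge1Dx (- d); have := expR_gt0 d; rewrite expRN => e0 ed.
have {}ed : expR d - 1 <= expR d * d.
  have := ler_wpM2l (ltW e0) ed; rewrite divff ?gt_eqF // mulrDr mulr1 mulrN.
  by lra.
have e1 : 0 <= expR d - 1 by have := expR_ge1Dx d; lra.
have := ler_wpM2l e1 dc.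
have h0 := Hlim_ge0 r.+1 j.
by move: (expR d) (Hlim r.+1 j) h0 e0 ed e1 => e h h0 e0 ed e1; nra.
Qed.

(** The sums of the odd iterates are bounded by [D], so they cannot grow by more than [eps] at every
    step. *)
Lemma Hlim_close eps : 0 < eps ->
  exists k, \sum_(j < D) (Hlim k.*2.+3 j - Hlim k.*2.+1 j) <= eps.
Proof.
move=> eps0; pose s k := \sum_(j < D) Hlim k.*2.+1 j.
have sE k : \sum_(j < D) (Hlim k.*2.+3 j - Hlim k.*2.+1 j) = s k.+1 - s k.
  by rewrite sumrB.
have s_le k : s k <= D%:R.
  rewrite -[D in D%:R]card_ord -sumr_const; apply: ler_sum => j _; exact: Hlim_le1.
apply: contrapT => /forallNP no.
have grow k : k%:R * eps <= s k.
  elim: k => [|k IH]; first by rewrite mul0r sumr_ge0 // => j _; exact: Hlim_ge0.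
  have /negP := no k; rewrite sE -ltNge => h; rewrite -natr1 mulrDl mul1r; lra.
have /archi_boundP : 0 <= D%:R / eps by rewrite divr_ge0 // ltW.
rewrite ltr_pdivrMr // => h.
have := le_trans (grow (Num.bound (D%:R / eps))) (s_le _).
by rewrite leNgt h.
Qed.

(* Even and odd iterates are monotone and bounded, hence some Hlim r.+2 is close to
   Hlim r; by symmetry of B this makes Hlim r.+2 0 and Hlim r.+1 0 close. *)
Lemma Hlim_Klim eps : 0 < eps ->
  exists2 r, ~~ odd r & Hlim r 0 <= Klim r 0 + 2 * c 0 + eps.
Proof.
move=> eps0; have c1 : 0 < c 0 + 1 by have := c_ge0 0; lra.
have [k hk] := Hlim_close (divr_gt0 eps0 c1).
exists k.*2.+2; first by rewrite /= negbK odd_double.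
set r := k.*2.+1 in hk *.
have /andP[_ b1] := Hlim_balance r.+1; have /andP[b0 _] := Hlim_balance r.
(* After the symmetric swap the difference is B (H_(r+2) - H_r) H_(r+1), at most c 0 times the sum
   made small by [hk]. *)
have diff : B (Hlim r.+2) (Hlim r.+1) - B (Hlim r.+1) (Hlim r) <= eps.
  rewrite [X in _ - X]BC -sumrB.
  apply: (@le_trans _ _ (\sum_(j < D) c 0 * (Hlim r.+2 j - Hlim r j))).
    apply: ler_sum => j _; rewrite -sumrB.
    have dj : 0 <= Hlim r.+2 j - Hlim r j.
      by rewrite subr_ge0; have := Hlim_alt r j; rewrite /r /= odd_double.
    apply: (@le_trans _ _ (\sum_(i < D) a (i + j) * (Hlim r.+2 j - Hlim r j))).
      apply: ler_sum => i _; rewrite -mulrBl -mulrBr ler_piMr ?Hlim_le1 //.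
      by rewrite mulr_ge0.
    rewrite -mulr_suml ler_wpM2r //; apply: le_trans (sum_c_le j.+1).
    by apply: ler_sum => i _; rewrite addnS.
  rewrite -mulr_sumr; apply: le_trans (ler_wpM2l (c_ge0 0) hk) _.
  rewrite mulrCA -[leRHS]mulr1 ler_wpM2l ?ltW //.
  by rewrite ltr_pdivrMr // mul1r; lra.
(* The two exponents differ by one grid step. This costs one of the two terms c 0 in the claim; the
   other comes from [Hlim_balance]. *)
have KE : Hlim r.+2 0 * (1 - c 0) <= Klim r.+1 0.
  have -> : Klim r.+1 0 = Hlim r.+2 0 * expR (- \sum_(i < D) (c i - c i.+1) * Hlim r.+1 i).
    rewrite HlimS /Klim -expRD -!sumrN -big_split; congr (expR _).
    by apply: eq_bigr => i _; rewrite addn0 addn1 /=; ring.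
  rewrite ler_wpM2l ?Hlim_ge0 //; apply: le_trans (expR_ge1Dx _).
  rewrite lerD2l lerN2; apply: le_trans (sum_c_le 0).
  by apply: ler_sum => i _; rewrite addn0 ler_piMr ?subr_ge0 ?Hlim_le1.
have := ler_wpM2l (c_ge0 0) (Hlim_le1 r.+2 0).
move: (B _ _) (B _ _) (Hlim r.+2 0) (Hlim r.+1 0) (Klim _ _) (c 0) b0 b1 KE diff.
by move=> *; lra.
Qed.

End LimitRecursion.

(** * Finite product measures *)

Section ProductExpectation.
Context {R : realType} {I : finType} {K : nat}.
Variable p : I -> 'I_K -> R.
Hypothesis p_ge0 : forall i a, 0 <= p i a.
Hypothesis p_sum1 : forall i, \sum_a p i a = 1.
Implicit Types (f : {ffun I -> 'I_K}) (phi psi : {ffun I -> 'I_K} -> R).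

Definition Ex phi := \sum_(f : {ffun I -> 'I_K}) (\prod_i p i (f i)) * phi f.

Let mu_ge0 f : 0 <= \prod_i p i (f i). Proof. exact: prodr_ge0. Qed.

Lemma Ex_le phi psi : (forall f, phi f <= psi f) -> Ex phi <= Ex psi.
Proof. by move=> h; apply: ler_sum => f _; rewrite ler_wpM2l. Qed.

Lemma eq_Ex phi psi : phi =1 psi -> Ex phi = Ex psi.
Proof. by move=> h; apply: eq_bigr => f _; rewrite h. Qed.

Lemma Ex_ge0 phi : (forall f, 0 <= phi f) -> 0 <= Ex phi.
Proof. by move=> h; apply: sumr_ge0 => f _; rewrite mulr_ge0. Qed.

Lemma ExD phi psi : Ex (fun f => phi f + psi f) = Ex phi + Ex psi.
Proof. by rewrite /Ex -big_split; apply: eq_bigr => f _; rewrite mulrDr. Qed.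

Lemma ExZ a phi : Ex (fun f => a * phi f) = a * Ex phi.
Proof. by rewrite /Ex mulr_sumr; apply: eq_bigr => f _; rewrite mulrCA. Qed.

Lemma ExN phi : Ex (fun f => - phi f) = - Ex phi.
Proof. by rewrite -[RHS]mulN1r -ExZ; apply: eq_Ex => f; rewrite mulN1r. Qed.

Lemma Ex_sum (J : Type) (s : seq J) (P : pred J) (phi : J -> {ffun I -> 'I_K} -> R) :
  Ex (fun f => \sum_(j <- s | P j) phi j f) = \sum_(j <- s | P j) Ex (phi j).
Proof. by rewrite /Ex exchange_big; apply: eq_bigr => f _; rewrite mulr_sumr. Qed.

Lemma Ex_cst a : Ex (fun=> a) = a.
Proof.
rewrite /Ex -mulr_suml -[RHS]mul1r; congr (_ * _).
rewrite -(bigA_distr_bigA (fun i a => p i a)) /=.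
by rewrite big1 // => i _; rewrite p_sum1.
Qed.

Definition upd f i a : {ffun I -> 'I_K} := [ffun j => if j == i then a else f j].

(** Resampling a coordinate: adjoin an independent copy [a] of coordinate [i] and exchange it with
    [f i]; this involution preserves the product weight. *)
Lemma Ex_upd i phi : Ex phi = Ex (fun f => \sum_a p i a * phi (upd f i a)).
Proof.
pose h (x : {ffun I -> 'I_K} * 'I_K) := (upd x.1 i x.2, x.1 i).
have hK : involutive h.
  case=> f a; rewrite /h /= ffunE eqxx; congr (_, _).
  by apply/ffunP => j; rewrite !ffunE; case: eqP => [->|].
have muE f a : (\prod_j p j (upd f i a j)) * p i (f i) = (\prod_j p j (f j)) * p i a.
  rewrite (bigD1 i) //= [in RHS](bigD1 i) //= ffunE eqxx.
  rewrite (eq_bigr (fun j => p j (f j))) => [|j ji]; last by rewrite ffunE (negbTE ji).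
  by rewrite mulrAC [RHS]mulrC mulrA.
pose G (x : {ffun I -> 'I_K} * 'I_K) := (\prod_j p j (x.1 j)) * p i x.2 * phi (upd x.1 i x.2).
transitivity (\sum_x G (h x)); last first.
  have <- : \sum_x G x = \sum_x G (h x) by exact: (reindex_inj (inv_inj hK)).
  rewrite /Ex.
  under [RHS]eq_bigr do rewrite mulr_sumr.
  by rewrite pair_bigA; apply: eq_bigr => -[f a] _; rewrite /G /= mulrA.
transitivity (\sum_(x : {ffun I -> 'I_K} * 'I_K)
    (\prod_j p j (x.1 j)) * phi x.1 * p i x.2).
  rewrite -(pair_bigA _ (fun f a => (\prod_j p j (f j)) * phi f * p i a)) /=.
  by apply: eq_bigr => f _; rewrite -mulr_sumr p_sum1 mulr1.
apply: eq_bigr => -[f a] _; rewrite /G /= muE mulrAC; congr (_ * phi _).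
by have [] := hK (f, a).
Qed.

(** Integrates out the coordinates [e u] one at a time. The thresholds [B u] are random, but neither
    they nor [phi] depend on these coordinates. *)
Lemma Ex_cond (U : eqType) (s : seq U) (e : U -> I) (B : U -> {ffun I -> 'I_K} -> nat) phi :
  uniq s -> {in s &, injective e} ->
  (forall u f a, u \in s -> phi (upd f (e u) a) = phi f) ->
  (forall u u' f a, u \in s -> u' \in s -> B u' (upd f (e u) a) = B u' f) ->
  Ex (fun f => phi f * \prod_(u <- s) (f (e u) <= B u f)%N%:R) =
  Ex (fun f => phi f * \prod_(u <- s) \sum_(a < K | (a <= B u f)%N) p (e u) a).
Proof.
elim: s phi => [|u s IH] phi /=; first by move=> *; apply: eq_Ex => f; rewrite !big_nil.
case/andP=> us un inj hphi hB.
have inS w : w \in s -> w \in u :: s by rewrite inE orbC => ->.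
have uS : u \in u :: s by rewrite inE eqxx.
have neq w : w \in s -> (e u == e w) = false.
  move=> ws; apply/eqP => /inj euw; move: us.
  by rewrite (euw uS (inS _ ws)) ws.
transitivity (Ex (fun f => (phi f * (f (e u) <= B u f)%N%:R) *
    \prod_(w <- s) \sum_(a < K | (a <= B w f)%N) p (e w) a)).
  rewrite -IH //.
  - by apply: eq_Ex => f; rewrite big_cons mulrA.
  - by move=> w w' /inS ws /inS ws'; apply: inj.
  - move=> w f a ws; rewrite (hphi _ _ _ (inS _ ws)) (hB _ _ _ _ (inS _ ws) uS).
    by rewrite ffunE neq.
  - by move=> w w' f a /inS ws /inS ws'; apply: hB.
rewrite (Ex_upd (e u)); apply: eq_Ex => f; rewrite big_cons mulrA.
rewrite [in RHS]big_mkcond /= mulr_sumr mulr_suml; apply: eq_bigr => a _.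
rewrite (hphi _ _ _ uS) (hB _ _ _ _ uS uS) ffunE eqxx.
rewrite (eq_big_seq (fun w => \sum_(a < K | (a <= B w f)%N) p (e w) a)) => [|w ws]; last first.
  by rewrite (hB _ _ _ _ uS (inS _ ws)).
by case: (a <= B u f)%N; rewrite /= ?mulr0n ?mulr1n; ring.
Qed.

Lemma Ex_indep (e : I) (A : pred 'I_K) phi :
  (forall f a, phi (upd f e a) = phi f) ->
  Ex (fun f => (A (f e))%:R * phi f) = (\sum_(a | A a) p e a) * Ex phi.
Proof.
move=> hphi; rewrite (Ex_upd e) -ExZ; apply: eq_Ex => f.
rewrite big_mkcond mulr_suml [in RHS]big_mkcond /=; apply: eq_bigr => a _.
by rewrite hphi ffunE eqxx mulrA; case: (A a); rewrite ?mulr1 ?mulr0 ?mul0r.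
Qed.

Lemma Ex_markov (A : pred {ffun I -> 'I_K}) phi t : 0 < t ->
  (forall f, 0 <= phi f) -> (forall f, A f -> t <= phi f) ->
  Ex (fun f => (A f)%:R) <= Ex phi / t.
Proof.
move=> t0 phi0 h; rewrite ler_pdivlMr // mulrC -ExZ; apply: Ex_le => f.
by case: (boolP (A f)) => [/h|_]; rewrite ?mulr1 ?mulr0.
Qed.

End ProductExpectation.

(** * Elementary inequalities and identities *)

Lemma expR_dist (R : realType) (x y : R) : 0 <= x -> 0 <= y ->
  `|expR (- x) - expR (- y)| <= `|x - y|.
Proof.
wlog xy : x y / x <= y => [h x0 y0|x0 y0].
  by case: (leP x y) => [|/ltW] xy; [|rewrite distrC [leRHS]distrC]; exact: h.
rewrite ger0_norm ?subr_ge0 ?ler_expR ?lerN2 // ler0_norm ?subr_le0 // opprB.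
have e1 : expR (- y) = expR (- x) * expR (- (y - x)) by rewrite -expRD; congr expR; lra.
have := expR_ge1Dx (- (y - x)); rewrite e1.
have : expR (- x) <= 1 by rewrite -[leRHS]expR0 ler_expR oppr_le0.
have := expR_gt0 (- x).
by move: (expR _) (expR _) => a b a0 a1 ab; nra.
Qed.

Lemma sqr_sum_le (R : realFieldType) n (x : 'I_n -> R) :
  (\sum_i x i) ^+ 2 <= n%:R * \sum_i x i ^+ 2.
Proof.
have -> : n%:R * (\sum_i x i ^+ 2)
    = \sum_i \sum_j (x i ^+ 2 + x j ^+ 2) / 2.
  under [RHS]eq_bigr do rewrite -mulr_suml big_split /= sumr_const card_ord.
  rewrite -mulr_suml big_split /= sumr_const card_ord sumrMnl -[_ *+ n]mulr_natl.
  by field.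
rewrite expr2 big_distrlr /=; apply: ler_sum => i _; apply: ler_sum => j _.
by have := sqr_ge0 (x i - x j); rewrite expr2; nra.
Qed.

Lemma prod_boolR (R : comNzRingType) (U : finType) (S : {set U}) (b : U -> bool) :
  \prod_(u <- enum S) (b u)%:R = [forall (u | u \in S), b u]%:R :> R.
Proof.
rewrite big_enum /=; case: forall_inP => [h|h].
  by rewrite big1 // => u uS; rewrite h.
have [u /andP[uS bu]] : exists u, (u \in S) && ~~ b u.
  by apply/existsP; rewrite -[X in is_true X]negbK negb_exists; apply/negP => /forallP h';
    apply: h => u uS; have := h' u; rewrite uS negbK.
by rewrite (bigD1 u) //= (negbTE bu) mul0r.
Qed.

(** Summation by parts: a function of an explored value [b] becomes a linear combination of the
    indicators of [b <= i], hence its average is linear in the empirical law. *)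
Lemma sum_truncated (R : zmodType) D (g : nat -> R) (b j : nat) :
  (forall m, (D <= m)%N -> g m = 0) ->
  \sum_(i < D) (g (i + j)%N - g (i + j).+1) *+ (b <= i)%N = g (b + j)%N.
Proof.
move=> g0; case: (leqP b D) => bD; last first.
  rewrite big1 ?g0 // ?(leq_trans (ltnW bD)) ?leq_addr // => i _.
  by rewrite leqNgt (ltn_trans (ltn_ord i) bD).
rewrite -(big_mkord xpredT (fun i => (g (i + j)%N - g (i + j).+1) *+ (b <= i)%N)).
rewrite (@big_cat_nat _ _ _ b) //= big1_seq ?add0r; last first.
  by move=> i; rewrite mem_index_iota => /andP[_ /andP[_ ib]]; rewrite leqNgt ib.
rewrite (eq_big_nat _ _ (F2 := fun i => - (g (i.+1 + j)%N - g (i + j)%N))).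
  by rewrite sumrN telescope_sumr // opprB [g (D + j)%N]g0 ?leq_addr ?subr0.
by move=> i /andP[bi _]; rewrite bi mulr1n opprB.
Qed.

Lemma card_setN (R : pzRingType) (T : finType) (P : pred T) :
  #|[set v | ~~ P v]%SET|%:R = #|T|%:R - \sum_(v in [set: T]%SET) (P v)%:R :> R.
Proof.
have -> : \sum_(v in [set: T]%SET) (P v)%:R = #|[set v | P v]%SET|%:R :> R.
  rewrite -sum1_card natr_sum big_mkcond [RHS]big_mkcond; apply: eq_bigr => v _.
  by rewrite !inE; case: (P v).
rewrite -(cardsC [set v | P v]%SET) natrD addrAC subrr add0r; congr (_%:R).
by apply: eq_card => v; rewrite !inE.
Qed.

(** * Concentration of the explored values *)

Section RandomGraph.
Context {R : realType} {T : finType} {K : nat}.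
Variables (p : {set T} -> 'I_K -> R) (D : nat) (g : nat -> R).
Hypothesis p_ge0 : forall e a, 0 <= p e a.
Hypothesis p_sum1 : forall e, \sum_a p e a = 1.
Hypothesis g_noninc : forall m, g m.+1 <= g m.
Hypothesis g_eq0 : forall m, (D <= m)%N -> g m = 0.
Hypothesis T_gt0 : (0 < #|T|)%N.
Hypothesis p_law : forall (e : {set T}) m, #|e| = 2%N ->
  \sum_(a < K | (a <= m)%N) p e a = expR (- (g m / #|T|%:R)).

Let N : R := #|T|%:R.
Let N_ge1 : 1 <= N. Proof. by rewrite /N ler1n. Qed.
Let N_gt0 : 0 < N. Proof. exact: lt_le_trans N_ge1. Qed.
Let c m := g m - g m.+1.
Notation graph := {ffun {set T} -> 'I_K}.
Implicit Types (f : graph) (S : {set T}) (u v w : T).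

Definition wt f (e : {set T}) : nat := f e.
Notation b f := (explore (wt f)).
Notation stuck f := (stuckb (wt f)).
Notation E := (Ex p).

Lemma g_ge0 m : 0 <= g m.
Proof.
case: (leqP D m) => [/g_eq0->//|/ltnW mD].
rewrite -(g_eq0 (leqnn D)) -(subnKC mD).
by elim: (D - m)%N => [|k IH]; rewrite ?addn0 // addnS; exact: le_trans IH.
Qed.

Let c_ge0 m : 0 <= c m. Proof. by rewrite subr_ge0. Qed.

Lemma g_le0 m : g m <= g 0.
Proof. by elim: m => // m; apply: le_trans. Qed.

Lemma c_le m : c m <= g 0.
Proof. by apply: le_trans (g_le0 m); rewrite gerBl g_ge0. Qed.

Lemma wt_upd f v u S a x y : v \notin S -> x \in S -> y \in S ->
  wt (upd f [set v; u] a) [set x; y] = wt f [set x; y].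
Proof.
move=> vS xS yS; rewrite /wt ffunE ifN //.
apply: contraNneq vS => /setP/(_ v); rewrite !inE eqxx /= => /orP[]/eqP->//.
Qed.

Lemma b_upd r f v u S a w : v \notin w |: S ->
  b (upd f [set v; u] a) r S w = b f r S w.
Proof. by move=> vS; apply: explore_local => x y xS yS; apply: wt_upd xS yS. Qed.

Lemma stuck_upd r j f v u S a w : v \notin w |: S ->
  stuck (upd f [set v; u] a) r j S w = stuck f r j S w.
Proof.
move=> vS; apply: eq_forallb_in => z zS.
rewrite (@wt_upd _ _ _ (w |: S)) ?inE ?eqxx ?zS ?orbT //; last first.
  by move: vS; rewrite !inE.
by rewrite b_upd // finset.setD1K //; apply: contra vS; rewrite !inE => ->; rewrite orbT.
Qed.

(** Divided by the total number of vertices even when [S] is smaller; the induction only meets sets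
    that miss boundedly many vertices. *)
Definition frac r i S f : R := (\sum_(u in S) (b f r (S :\ u) u <= i)%N%:R) / N.

Lemma frac_upd r i f v u S a : v \notin S -> frac r i S (upd f [set v; u] a) = frac r i S f.
Proof.
move=> vS; congr (_ / _); apply: eq_bigr => z zS; rewrite b_upd //.
by rewrite finset.setD1K.
Qed.

(** [expR (- expo r j S f)] is the conditional probability that a vertex outside [S] is stuck, given
    the graph on [S]. It is written through [frac] to be comparable with [Klim]. *)
Definition expo r j S f := \sum_(i < D) c (i + j) * frac r i S f.

Lemma expoE r j S f : expo r j S f = \sum_(u in S) g (j + b f r (S :\ u) u) / N.
Proof.
rewrite /expo /frac -[RHS]mulr_suml.
under eq_bigr do rewrite mulrA; rewrite -mulr_suml; congr (_ / _).
under eq_bigr do rewrite mulr_sumr; rewrite exchange_big; apply: eq_bigr => u _.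
rewrite addnC -(sum_truncated (b f r (S :\ u) u) j g_eq0); apply: eq_bigr => i _.
by rewrite mulr_natr.
Qed.

(** The edges from [v] to [S] are independent of the values explored inside [S], so [Ex_cond]
    applies with these values as thresholds. *)
Lemma Ex_stuck r j S v phi : v \notin S ->
  (forall f u a, u \in S -> phi (upd f [set v; u] a) = phi f) ->
  E (fun f => phi f * (stuck f r j S v)%:R) = E (fun f => phi f * expR (- expo r j S f)).
Proof.
move=> vS hphi.
have enumS u : (u \in enum S) = (u \in S) by rewrite mem_enum.
transitivity (E (fun f => phi f *
    \prod_(u <- enum S) (f [set v; u] <= j + b f r (S :\ u) u)%N%:R)).
  by apply: eq_Ex => f; rewrite prod_boolR.
have neq u : u \in S -> v != u by move=> uS; apply: contraNneq vS => ->.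
rewrite Ex_cond //.
- apply: eq_Ex => f; congr (_ * _); rewrite expoE -sumrN expR_sum big_enum /=.
  apply: eq_bigr => u uS; rewrite p_law ?mulNr //.
  by rewrite cards2 neq.
- exact: enum_uniq.
- move=> u u'; rewrite !enumS => uS u'S /setP/(_ u); rewrite !inE eqxx orbT.
  by rewrite eq_sym (negbTE (neq _ uS)) => /esym/eqP.
- by move=> u f a; rewrite enumS; apply: hphi.
- move=> u u' f a; rewrite !enumS => uS u'S; rewrite b_upd //.
  by rewrite finset.setD1K.
Qed.

Lemma edge_prob_le (e : {set T}) (phi : graph -> R) : #|e| = 2%N -> (forall f a, phi (upd f e a) = phi f) ->
  (forall f, 0 <= phi f) ->
  E (fun f => (0 < f e)%N%:R * phi f) <= g 0 / N * E phi.
Proof.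
move=> e2 hphi phi0.
rewrite (@Ex_indep _ _ _ _ p_sum1 e (fun a : 'I_K => (0 < a)%N)) //.
rewrite ler_wpM2r ?Ex_ge0 //.
have := p_sum1 e; rewrite (bigID (fun a : 'I_K => (a <= 0)%N)) /= p_law //.
under [X in _ + X]eq_bigl do rewrite -ltnNge.
by have := expR_ge1Dx (- (g 0 / N)); rewrite /N; lra.
Qed.

(** Deleting [w] can affect [v] only through a usable edge to [w], or through a usable edge to some
    [u] whose own value changes. *)
Lemma game_stable f r S w v : w \in S -> f [set v; w] = 0%N :> nat ->
  (forall u, u \in S :\ w -> f [set v; u] = 0%N :> nat \/
     b f r (S :\ u) u = b f r (S :\ u :\ w) u) ->
  b f r.+1 S v = b f r.+1 (S :\ w) v /\
  forall j, stuck f r j S v = stuck f r j (S :\ w) v.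
Proof.
move=> wS w0 h.
have DC u : S :\ w :\ u = S :\ u :\ w by rewrite !finset.setDDl finset.setUC.
split=> [/=|j].
  rewrite (big_setD1 w) //= {1}/wt w0 sub0n max0n; apply: eq_bigr => u uS.
  by rewrite DC; have [u0|->//] := h u uS; rewrite /wt u0 !sub0n.
apply/forall_inP/forall_inP => h1 u uS; last first.
  have [->|uw] := eqVneq u w; first by rewrite /wt w0.
  have uSw : u \in S :\ w by rewrite !inE uw.
  by have [u0|->] := h u uSw; [rewrite /wt u0|rewrite -DC h1].
have uS' : u \in S by move: uS; rewrite !inE => /andP[].
by have [u0|] := h u uS; [rewrite /wt u0|rewrite DC => <-; rewrite h1].
Qed.

Fixpoint stabC r : R := if r is r'.+1 then g 0 * (1 + stabC r') else 0.

Lemma stabC_ge0 r : 0 <= stabC r.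
Proof. by elim: r => //= r IH; rewrite mulr_ge0 ?g_ge0 // addr_ge0. Qed.

(** Union bound over the two causes in [game_stable]. The edge to [w] is usable with probability at
    most g 0 / N; for each of at most N other [u], the edge to [v] is independent of a change at
    [u], which gives g 0 / N times stabC r / N. The abstract event [A] covers both [explore] and
    [stuckb]. *)
Lemma Ex_stable r S w v (A : pred graph) : w \in S -> v \notin S ->
  (forall u, u \in S :\ w ->
     E (fun f => (b f r (S :\ u) u != b f r (S :\ u :\ w) u)%:R) <= stabC r / N) ->
  (forall f, A f -> ~ (b f r.+1 S v = b f r.+1 (S :\ w) v /\
     forall j, stuck f r j S v = stuck f r j (S :\ w) v)) ->
  E (fun f => (A f)%:R) <= stabC r.+1 / N.
Proof.
move=> wS vS IH hA.
have neq u : u \in S -> v != u by move=> uS; apply: contraNneq vS => ->.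
apply: (@le_trans _ _ (E (fun f => (0 < f [set v; w])%N%:R * 1 +
    \sum_(u in S :\ w) (0 < f [set v; u])%N%:R *
      (b f r (S :\ u) u != b f r (S :\ u :\ w) u)%:R))).
  apply: Ex_le => // f; case: (boolP (A f)) => [/hA nst|_]; last first.
    by rewrite addr_ge0 // sumr_ge0 // => u _; rewrite mulr_ge0.
  case: (posnP (f [set v; w])) => [w0|wpos]; last first.
    by rewrite mulr1 lerDl sumr_ge0 // => u _; rewrite mulr_ge0.
  rewrite mul0r add0r.
  have [/exists_inP[u uS /andP[u0 bu]]|/exists_inPn no] := boolP [exists u in S :\ w,
      (0 < f [set v; u])%N && (b f r (S :\ u) u != b f r (S :\ u :\ w) u)].
    rewrite (bigD1 u) //= u0 bu mulr1 lerDl sumr_ge0 //.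
  exfalso; apply: nst; apply: game_stable => // u uS.
  have := no u uS; rewrite negb_and -leqNgt leqn0 negbK => /orP[]/eqP; by [left|right].
rewrite ExD Ex_sum /= mulrDr mulr1 mulrDl lerD //.
  apply: le_trans (edge_prob_le _ _ _) _ => //; first by rewrite cards2 neq.
  by rewrite Ex_cst // mulr1.
apply: (@le_trans _ _ (\sum_(u in S :\ w) g 0 / N * (stabC r / N))).
  apply: ler_sum => u uS; have uS' : u \in S by move: uS; rewrite !inE => /andP[].
  apply: le_trans (edge_prob_le _ _ _) _ => //.
  - by rewrite cards2 neq.
  - move=> f a; rewrite !b_upd //.
      by apply: contra vS; rewrite !inE => /orP[/eqP->//|/and3P[]].
    by rewrite finset.setD1K.
  - by rewrite ler_wpM2l ?IH // divr_ge0 ?g_ge0 // ltW.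
rewrite sumr_const -mulr_natl.
have : #|S :\ w|%:R <= N by rewrite ler_nat max_card.
have := stabC_ge0 r; have := g_ge0 0; move: (stabC r) (g 0) (#|_|%:R) => s q k q0 s0 kN.
have -> : k * (q / N * (s / N)) = (k / N) * (q * s / N) by field; rewrite gt_eqF.
by rewrite ler_piMl // ?ler_pdivrMr ?mul1r // divr_ge0 ?mulr_ge0 // ltW.
Qed.

Lemma Ex_explore_stable r S w v : w \in S -> v \notin S ->
  E (fun f => (b f r S v != b f r (S :\ w) v)%:R) <= stabC r / N.
Proof.
elim: r S w v => [|r IH] S w v wS vS; first by rewrite mul0r Ex_cst.
apply: (@Ex_stable r S w v) => // [u uS|f /eqP nb [//]].
by apply: IH; rewrite !inE ?eqxx //; move: uS; rewrite !inE eq_sym => /andP[-> _].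
Qed.

Lemma Ex_stuck_stable r j S w v : w \in S -> v \notin S ->
  E (fun f => (stuck f r j S v != stuck f r j (S :\ w) v)%:R) <= stabC r.+1 / N.
Proof.
move=> wS vS; apply: (@Ex_stable r S w v) => // [u uS|f /eqP nb [_ /(_ j)]//].
apply: Ex_explore_stable; rewrite !inE ?eqxx //.
by move: uS; rewrite !inE eq_sym => /andP[-> _].
Qed.


Notation H := (Hlim D c).
Notation k := (Klim D c).

Lemma expo_ge0 r j S f : 0 <= expo r j S f.
Proof. by rewrite expoE sumr_ge0 // => u _; rewrite divr_ge0 ?g_ge0 // ltW. Qed.

(** The exponential is 1-Lipschitz on nonpositive arguments; then Cauchy-Schwarz over the [D] values
    of i. *)
Lemma frac_sq_le r j S f :
  (expR (- expo r j S f) - k r j) ^+ 2 <=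
  D%:R * g 0 ^+ 2 * \sum_(i < D) (frac r i S f - H r i) ^+ 2.
Proof.
apply: (@le_trans _ _ ((\sum_(i < D) c (i + j) * (frac r i S f - H r i)) ^+ 2)).
  have -> : \sum_(i < D) c (i + j) * (frac r i S f - H r i)
      = expo r j S f - \sum_(i < D) c (i + j) * H r i.
    by rewrite /expo -sumrB; apply: eq_bigr => i _; rewrite mulrBr.
  rewrite -[leLHS]real_normK ?num_real // -[leRHS]real_normK ?num_real //.
  rewrite ler_pXn2r ?nnegrE // expR_dist ?expo_ge0 // sumr_ge0 // => i _.
  by rewrite mulr_ge0 // Hlim_ge0.
apply: le_trans (sqr_sum_le _) _; rewrite -mulrA ler_wpM2l // mulr_sumr.
apply: ler_sum => i _; rewrite exprMn ler_wpM2r ?sqr_ge0 //.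
by rewrite ler_pXn2r ?nnegrE ?g_ge0 // c_le.
Qed.

Lemma k_itv r j : 0 <= k r j <= 1.
Proof.
rewrite /Klim expR_ge0 -[X in _ <= X]expR0 ler_expR oppr_le0.
by apply: sumr_ge0 => i _; rewrite mulr_ge0 // Hlim_ge0.
Qed.

(** Here kap^2 accounts for the vertices missing from [S], 1 for the diagonal of the variance and
    the rest for the covariances; the factor 2 comes from (y - t)^2 <= 2 y^2 + 2 t^2. *)
Definition stuckB r (M : R) (kap : nat) : R :=
  2 * (kap%:R ^+ 2 + (1 + (2 * stabC r.+1 + D%:R * g 0 ^+ 2 * (D%:R * M)))).

(* Deleting u and w from the vertex set changes the two events with probability
   O(1/n) and makes them conditionally independent given the remaining graph. *)
Lemma Ex_stuck_cov r j S u w M : u \in S -> w \in S -> u != w ->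
  (forall i, E (fun f => (frac r i (S :\ u :\ w) f - H r i) ^+ 2) <= M / N) ->
  E (fun f => ((stuck f r j (S :\ u) u)%:R - k r j) *
              ((stuck f r j (S :\ w) w)%:R - k r j)) <=
  (2 * stabC r.+1 + D%:R * g 0 ^+ 2 * (D%:R * M)) / N.
Proof.
move=> uS wS uw hM; set S2 := S :\ u :\ w in hM *.
have DC : S :\ w :\ u = S2 by rewrite /S2 !finset.setDDl finset.setUC.
have uS2 : u \notin S2 by rewrite !inE eqxx andbF.
have wS2 : w \notin S2 by rewrite !inE eqxx.
have /andP[k0 k1] := k_itv r j.
set kk := k r j in k0 k1 *.
(* The edges from [u] to [S2] and from [w] to [S2] are disjoint, so each indicator in turn is
   replaced by its conditional probability. *)
have indep : E (fun f => ((stuck f r j S2 u)%:R - kk) * ((stuck f r j S2 w)%:R - kk)) =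
    E (fun f => (expR (- expo r j S2 f) - kk) ^+ 2).
  transitivity (E (fun f => ((stuck f r j S2 w)%:R - kk) * (expR (- expo r j S2 f) - kk))).
    transitivity (E (fun f => ((stuck f r j S2 w)%:R - kk) * (stuck f r j S2 u)%:R)
        - kk * E (fun f => (stuck f r j S2 w)%:R - kk)).
      by rewrite -ExZ -ExN -ExD; apply: eq_Ex => f; ring.
    rewrite Ex_stuck //.
      by rewrite -ExZ -ExN -ExD; apply: eq_Ex => f; ring.
    move=> f z a zS2; rewrite stuck_upd // finset.in_setU1 negb_or uw.
    exact: uS2.
  transitivity (E (fun f => (expR (- expo r j S2 f) - kk) * (stuck f r j S2 w)%:R)
      - kk * E (fun f => expR (- expo r j S2 f) - kk)).
    by rewrite -ExZ -ExN -ExD; apply: eq_Ex => f; ring.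
  rewrite Ex_stuck //.
    by rewrite -ExZ -ExN -ExD; apply: eq_Ex => f; ring.
  move=> f z a zS2; congr (expR (- _) - _).
  by apply: eq_bigr => i _; rewrite frac_upd.
(* Both factors have absolute value at most 1, and changing one indicator changes the product by at
   most 1. *)
apply: (@le_trans _ _ (E (fun f =>
   ((stuck f r j S2 u)%:R - kk) * ((stuck f r j S2 w)%:R - kk) +
   ((stuck f r j (S :\ u) u != stuck f r j (S :\ u :\ w) u)%:R +
    (stuck f r j (S :\ w) w != stuck f r j (S :\ w :\ u) w)%:R)))).
  apply: Ex_le => // f; rewrite DC -/S2.
  by case: (stuck f r j S2 u); case: (stuck f r j S2 w);
    case: (stuck f r j (S :\ u) u); case: (stuck f r j (S :\ w) w); rewrite /=; nra.
rewrite !ExD indep.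
have h1 : E (fun f => (stuck f r j (S :\ u) u != stuck f r j (S :\ u :\ w) u)%:R)
    <= stabC r.+1 / N.
  by apply: Ex_stuck_stable; rewrite !inE ?eqxx // eq_sym uw.
have h2 : E (fun f => (stuck f r j (S :\ w) w != stuck f r j (S :\ w :\ u) w)%:R)
    <= stabC r.+1 / N.
  by apply: Ex_stuck_stable; rewrite !inE ?eqxx // uw.
have h3 : E (fun f => (expR (- expo r j S2 f) - kk) ^+ 2)
    <= D%:R * g 0 ^+ 2 * (D%:R * (M / N)).
  apply: le_trans (Ex_le p_ge0 (frac_sq_le r j S2)) _.
  have -> : D%:R * (M / N) = \sum_(i < D) M / N.
    by rewrite sumr_const card_ord mulr_natl.
  rewrite ExZ Ex_sum; apply: ler_wpM2l; first by rewrite mulr_ge0 ?sqr_ge0.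
  exact: ler_sum.
apply: le_trans (lerD h3 (lerD h1 h2)) _; rewrite le_eqVlt; apply/orP; left.
by apply/eqP; field; rewrite gt_eqF.
Qed.

(** Second moment: at most N diagonal terms bounded by 1 and N^2 covariances of order 1/N. Each
    covariance deletes two more vertices, hence [kap.+2]. *)
Lemma Ex_stuck_conc r j S kap M : 0 <= M -> (#|~: S| <= kap)%N ->
  (forall i S', (#|~: S'| <= kap.+2)%N ->
     E (fun f => (frac r i S' f - H r i) ^+ 2) <= M / N) ->
  E (fun f => ((\sum_(u in S) (stuck f r j (S :\ u) u)%:R) / N - k r j) ^+ 2)
    <= stuckB r M kap / N.
Proof.
move=> M0 Skap hM; have /andP[k0 k1] := k_itv r j.
set kk := k r j in k0 k1 *.
pose X u f := (stuck f r j (S :\ u) u)%:R - kk.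
pose q := 2 * stabC r.+1 + D%:R * g 0 ^+ 2 * (D%:R * M).
have q0 : 0 <= q.
  apply: addr_ge0; first exact: (@mulr_ge0 _ 2 _ _ (stabC_ge0 r.+1)).
  by rewrite !mulr_ge0 ?sqr_ge0 ?g_ge0.
have cS : #|S|%:R + #|~: S|%:R = N by rewrite -natrD cardsC.
have cSk : #|~: S|%:R <= kap%:R :> R by rewrite ler_nat.
have cS0 : 0 <= #|S|%:R :> R by [].
have cSC0 : 0 <= #|~: S|%:R :> R by [].
apply: (@le_trans _ _ (E (fun f => 2 * (kap%:R ^+ 2 / N) +
    2 / N ^+ 2 * \sum_(u in S) \sum_(w in S) X u f * X w f))).
  apply: Ex_le => // f; rewrite -big_distrlr /= -/(X _ f).
  have -> : \sum_(u in S) (stuck f r j (S :\ u) u)%:R = \sum_(u in S) X u f + #|S|%:R * kk.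
    by rewrite sumrB sumr_const -[kk *+ _]mulr_natl subrK.
  set Y := \sum_(u in S) X u f.
  have -> : (Y + #|S|%:R * kk) / N - kk = Y / N - #|~: S|%:R * kk / N.
    have -> : #|S|%:R = N - #|~: S|%:R by rewrite -cS addrK.
    by field; rewrite gt_eqF.
  set t := #|~: S|%:R * kk / N.
  have t0 : 0 <= t by rewrite divr_ge0 ?mulr_ge0 // ltW.
  have tle : t ^+ 2 <= kap%:R ^+ 2 / N.
    rewrite /t expr_div_n; apply: (@le_trans _ _ (kap%:R ^+ 2 / N ^+ 2)).
      rewrite ler_wpM2r ?invr_ge0 ?sqr_ge0 // ler_pXn2r ?nnegrE ?mulr_ge0 //.
      by apply: le_trans cSk; rewrite ler_piMr.
    rewrite ler_wpM2l ?sqr_ge0 // lef_pV2 ?posrE ?exprn_gt0 //.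
    by rewrite expr2 ler_peMr // ltW.
  have -> : 2 / N ^+ 2 * (Y * Y) = 2 * (Y / N) ^+ 2 by field; rewrite gt_eqF.
  move: (Y / N) (kap%:R ^+ 2 / N) tle => y kN tle.
  by have := sqr_ge0 (y + t); rewrite !expr2 in tle *; nra.
rewrite ExD Ex_cst // ExZ Ex_sum.
have -> : stuckB r M kap / N = 2 * (kap%:R ^+ 2 / N) + 2 / N ^+ 2 * (N + N ^+ 2 * (q / N)).
  by rewrite /stuckB -/q; field; rewrite gt_eqF.
rewrite lerD2l ler_wpM2l ?divr_ge0 ?sqr_ge0 //.
have SN : #|S|%:R <= N by rewrite ler_nat max_card.
apply: (@le_trans _ _ (\sum_(u in S) (1 + \sum_(w in S) q / N))).
  apply: ler_sum => u uS; rewrite Ex_sum (bigD1 u) //= lerD //.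
    rewrite -[leRHS](Ex_cst p_sum1); apply: Ex_le => // f.
    by rewrite /X; case: (stuck _ _ _ _ _) => /=; nra.
  apply: (@le_trans _ _ (\sum_(w in S | w != u) q / N)); last first.
    by rewrite [leRHS](bigD1 u) //= lerDr divr_ge0 // ltW.
  apply: ler_sum => w /andP[wS wu]; apply: Ex_stuck_cov => //; first by rewrite eq_sym.
  move=> i; apply: hM; apply: leq_trans (_ : #|w |: (u |: ~: S)| <= _)%N.
    by apply/subset_leq_card/fintype.subsetP => z; rewrite !inE !negb_and !negbK.
  by rewrite !cardsU1 -[kap.+2]/(1 + (1 + kap))%N !leq_add ?leq_b1.
rewrite !sumr_const -[(q / N) *+ _]mulr_natl -[X in X <= _]mulr_natl mulrDr mulr1 lerD //.
rewrite [leLHS]mulrA; apply: ler_wpM2r; first by rewrite divr_ge0 // ltW.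
by rewrite expr2 ler_pM.
Qed.

(** The number of deleted vertices rises by two with each depth, so the induction on [r] must allow
    every [kap]. *)
Fixpoint concC r kap : R :=
  if r is r'.+1 then stuckB r' (concC r' kap.+2) kap else kap%:R ^+ 2.

Lemma concC_ge0 r kap : 0 <= concC r kap.
Proof.
elim: r kap => [|r IH] kap; first exact: sqr_ge0.
have Q : 0 <= D%:R * g 0 ^+ 2 * (D%:R * concC r kap.+2).
  by rewrite !mulr_ge0 ?g_ge0.
have := stabC_ge0 r.+1; have := sqr_ge0 (kap%:R : R); rewrite [concC _ _]/= /stuckB.
by move=> a0 b0; rewrite mulr_ge0 // !addr_ge0 // mulr_ge0.
Qed.

Lemma Ex_frac_conc r i S kap : (#|~: S| <= kap)%N ->
  E (fun f => (frac r i S f - H r i) ^+ 2) <= concC r kap / N.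
Proof.
elim: r i S kap => [|r IH] i S kap Skap; last first.
  have hM i' S' (h : (#|~: S'| <= kap.+2)%N) := IH i' S' kap.+2 h.
  apply: le_trans (Ex_stuck_conc i.+1 (concC_ge0 r kap.+2) Skap hM).
  by apply: Ex_le => // f; rewrite /frac; under eq_bigr do rewrite explore_leE.
rewrite -[leRHS](Ex_cst p_sum1); apply: Ex_le => // f.
rewrite /frac sumr_const -[H 0 i]/1.
have -> : #|S|%:R / N - 1 = - (#|~: S|%:R / N).
  have cS : #|S|%:R + #|~: S|%:R = N by rewrite -natrD cardsC.
  by rewrite -cS; field; rewrite cS gt_eqF.
rewrite sqrrN expr_div_n; apply: (@le_trans _ _ (kap%:R ^+ 2 / N ^+ 2)).
  by rewrite ler_wpM2r ?invr_ge0 ?sqr_ge0 // ler_pXn2r ?nnegrE // ler_nat.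
rewrite ler_wpM2l ?sqr_ge0 // lef_pV2 ?posrE ?exprn_gt0 //.
by rewrite expr2 ler_peMr // ltW.
Qed.


Definition typical r eps f := [forall m : {set {set T}}, optimal (wt f) m ==>
  (N * (1 - H r 0 - eps) <= (2 * #|m|)%:R <= N * (1 - k r 0 + eps))].

(** Markov's inequality for the sum of two squared deviations. Once both proportions are near their
    limits, the counting bounds hold for all optimal matchings at once. *)
Lemma Ex_typical r eps : ~~ odd r -> 0 < eps ->
  E (fun f => (~~ typical r eps f)%:R) <=
  (concC r 0 + stuckB r (concC r 2) 0) / eps ^+ 2 / N.
Proof.
move=> rev eps0; set V := [set: T]%SET.
have VC : (#|~: V| <= 0)%N by rewrite finset.setCT cards0.
have c1 := Ex_frac_conc r 0 VC.
have c2 := Ex_stuck_conc 0 (concC_ge0 r 2) VC (fun i S h => @Ex_frac_conc r i S 2 h).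
rewrite mulrAC mulrDl; apply: le_trans (ler_pM _ _ (lerD c1 c2) (lexx _)).
- rewrite -ExD; apply: Ex_markov => // [|f|f]; first by rewrite exprn_gt0.
    by rewrite addr_ge0 ?sqr_ge0.
  rewrite negb_forall => /existsP[m]; rewrite negb_imply => /andP[opt].
  have lo := optimal_lower opt rev; have up := optimal_upper opt rev.
  have loE : #|[set v | (0 < b f r (V :\ v) v)%N]%SET|%:R = N - N * frac r 0 V f.
    rewrite mulrC divfK ?gt_eqF // -(card_setN _ (fun v => (b f r (V :\ v) v <= 0)%N)).
    by congr (_%:R); apply: eq_card => v; rewrite !inE ltnNge.
  have upE : #|[set v | ~~ stuck f r 0 (V :\ v) v]%SET|%:R =
      N - N * ((\sum_(u in V) (stuck f r 0 (V :\ u) u)%:R) / N).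
    by rewrite mulrC divfK ?gt_eqF // card_setN.
  rewrite -(ler_nat R) loE in lo; rewrite -(ler_nat R) upE in up.
  rewrite negb_and -!ltNge => /orP[h|h].
    have : N * (1 - frac r 0 V f) < N * (1 - H r 0 - eps).
      by rewrite mulrBr mulr1; exact: le_lt_trans lo h.
    rewrite ltr_pM2l // => e1; have {}e1 : eps <= frac r 0 V f - H r 0 by lra.
    rewrite -[leLHS]addr0 lerD ?sqr_ge0 // ler_pXn2r // nnegrE ltW //.
    exact: lt_le_trans eps0 e1.
  set s := (\sum_(u in V) _) / N in up *.
  have : N * (1 - k r 0 + eps) < N * (1 - s).
    by rewrite [ltRHS]mulrBr mulr1; exact: lt_le_trans h up.
  rewrite ltr_pM2l // => e1; have {}e1 : eps <= k r 0 - s by lra.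
  rewrite -[leLHS]add0r lerD ?sqr_ge0 // -[leRHS]sqrrN opprB.
  rewrite ler_pXn2r // nnegrE ltW //; exact: lt_le_trans eps0 e1.
- by rewrite addr_ge0 ?Ex_ge0 // => f; exact: sqr_ge0.
- by rewrite invr_ge0 sqr_ge0.
Qed.

End RandomGraph.

Local Open Scope classical_set_scope.
Local Open Scope ring_scope.

(** * The random lengths *)

Section FiniteUnions.
Context {R : realType} {d} {T : measurableType d} (P : probability T R).
Context {J : eqType}.
Implicit Types (F : J -> set T) (s : seq J) (A : pred J).

Lemma bigsetUP s A F w : (\big[setU/set0]_(j <- s | A j) F j) w <->
  exists j, [/\ j \in s, A j & F j w].
Proof.
elim: s => [|i s IH]; first by rewrite big_nil; split=> // -[j []].
rewrite big_cons; split.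
  case: ifP => Ai; last by move=> /IH[j [js ? ?]]; exists j; rewrite inE js orbT.
  case=> [Fi|/IH[j [js ? ?]]]; first by exists i; rewrite inE eqxx.
  by exists j; rewrite inE js orbT.
case=> j []; rewrite inE => /predU1P[->|js] Aj Fj; first by rewrite Aj; left.
have h : (\big[setU/set0]_(j <- s | A j) F j) w by apply/IH; exists j.
by case: ifP => // _; right.
Qed.

Lemma measure_disjoint_bigsetU s A F : uniq s -> (forall j, measurable (F j)) ->
  (forall i j w, F i w -> F j w -> i = j) ->
  P (\big[setU/set0]_(j <- s | A j) F j) = (\sum_(j <- s | A j) P (F j))%E.
Proof.
move=> us mF dF; elim: s us => [|i s IH]; first by rewrite !big_nil measure0.
move=> /= /andP[is_ us]; rewrite !big_cons; case: ifP => Ai; last exact: IH.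
have mU : measurable (\big[setU/set0]_(j <- s | A j) F j) by exact: bigsetU_measurable.
rewrite measureU //; first by congr (_ + _)%E; exact: IH.
apply/seteqP; split=> // w [Fi /bigsetUP[j [js _ Fj]]].
by move: is_; rewrite (dF _ _ _ Fi Fj) js.
Qed.

Lemma measure_bigsetU_le s A F : (forall j, A j -> measurable (F j)) ->
  (P (\big[setU/set0]_(j <- s | A j) F j) <= \sum_(j <- s | A j) P (F j))%E.
Proof.
move=> mF; elim: s => [|i s IH]; first by rewrite !big_nil measure0.
rewrite !big_cons; case: ifP => // Ai.
have mU : measurable (\big[setU/set0]_(j <- s | A j) F j) by exact: bigsetU_measurable.
by apply: le_trans (measureU2 _ (mF i Ai) mU) _; exact: leeD2l.
Qed.

End FiniteUnions.

Section FiniteValued.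
Context {R : realType} {d} {T : measurableType d} (P : probability T R).
Context {J : finType} (h : T -> J).
Hypothesis mh : forall j, measurable [set w | h w = j].

Lemma preimage_finE (A : pred J) :
  [set w | A (h w)] = \big[setU/set0]_(j <- enum J | A j) [set w | h w = j].
Proof.
apply/seteqP; split=> w /=.
  by move=> Aw; apply/bigsetUP; exists (h w); rewrite mem_enum.
by move=> /bigsetUP[j [_ Aj /= ->]].
Qed.

Lemma measurable_fin (A : pred J) : measurable [set w | A (h w)].
Proof. by rewrite preimage_finE; exact: bigsetU_measurable. Qed.

Lemma prob_fin (A : pred J) : P [set w | A (h w)] = (\sum_(j | A j) P [set w | h w = j])%E.
Proof.
rewrite preimage_finE measure_disjoint_bigsetU ?enum_uniq ?big_enum_cond //.
by move=> i j w <- <-.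
Qed.

End FiniteValued.

Section Levels.
Context {R : realType}.
Variable dl : R.
Hypothesis dl0 : 0 < dl.

(* Equals t + 1 - (l / dl rounded up), and 0 when l > t dl. *)
Definition level t (l : R) : nat := \sum_(k < t.+1) (l <= k%:R * dl)%R.

Lemma levelS t l : level t.+1 l = (level t l + (l <= t.+1%:R * dl)%R)%N.
Proof. by rewrite /level big_ord_recr. Qed.

Lemma level_gt t l m : (m < level t l)%N = (m <= t)%N && (l <= (t - m)%:R * dl).
Proof.
elim: t m => [|t IH] m.
  rewrite /level big_ord_recl big_ord0 addn0 leqn0.
  by case: m => [|m]; case: (l <= _).
rewrite levelS; case: (boolP (l <= t.+1%:R * dl)) => h.
  by rewrite addn1; case: m => [|m]; rewrite ?subn0 ?h // ltnS IH subSS.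
have no j : (j <= t.+1)%N -> (l <= j%:R * dl) = false.
  move=> jt; apply: contraNF h => /le_trans; apply.
  by rewrite ler_wpM2r ?ler_nat // ltW.
by rewrite addn0 IH (no _ (leqW (leq_subr _ _))) (no _ (leq_subr _ _)) !andbF.
Qed.

Lemma level_le t l : (level t l <= t.+1)%N.
Proof. by rewrite leqNgt level_gt ltnn. Qed.

Variable d : R.
Hypothesis d1 : 1 <= d.
Let d0 : 0 < d. Proof. exact: lt_le_trans d1. Qed.

(* Convexity of x^d is the only use of d >= 1 in the limit recursion. *)
Lemma powR_midpoint (x y : R) : 0 <= x -> 0 <= y ->
  2 * powR ((x + y) / 2) d <= powR x d + powR y d.
Proof.
move=> x0 y0.
have h0 : (0 : R) <= 2^-1 by rewrite invr_ge0.
have h1 : (2^-1 : R) <= 1 by rewrite invf_le1 // ler1n.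
have := @convex_powR R d d1 (Itv01 h0 h1) x y.
rewrite !inE /= !in_itv /= !andbT => /(_ x0 y0).
rewrite convRE [X in powR X _ <= _]convRE /= => h.
have -> : (x + y) / 2 = 2^-1 * x + unstable.onem 2^-1 * y by rewrite /unstable.onem; field.
by move: h; rewrite {2}/unstable.onem; lra.
Qed.

(** Asymptotic mean number of edges at a vertex whose level exceeds [m], that is, of length at most
    (t - m) dl. *)
Definition glev t m : R := powR ((t - m)%:R * dl) d.

Lemma glev_noninc t m : glev t m.+1 <= glev t m.
Proof.
have ge0 k : 0 <= (t - k)%:R * dl by rewrite mulr_ge0 // ltW.
rewrite ge0_ler_powR ?nnegrE ?ge0 ?(ltW d0) //.
by rewrite ler_wpM2r ?(ltW dl0) // ler_nat; lia.
Qed.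



Lemma glev_eq0 t m : (t <= m)%N -> glev t m = 0.
Proof. by rewrite -subn_eq0 => /eqP h; rewrite /glev h mul0r powR0 // gt_eqF. Qed.

Lemma glev_convex t m : glev t m.+1 - glev t m.+2 <= glev t m - glev t m.+1.
Proof.
suff : 2 * glev t m.+1 <= glev t m + glev t m.+2 by lra.
(* Truncated subtraction breaks the midpoint identity for t <= m + 1, but then the left side is
   0. *)
have [tm|mt] := leqP t m.+1; first by rewrite glev_eq0 // mulr0 addr_ge0 ?powR_ge0.
have ge0 k : 0 <= k%:R * dl by rewrite mulr_ge0 // ltW.
have := powR_midpoint (ge0 (t - m)%N) (ge0 (t - m.+2)%N); rewrite /glev.
suff -> : ((t - m)%:R * dl + (t - m.+2)%:R * dl) / 2 = (t - m.+1)%:R * dl by [].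
have -> : (t - m = (t - m.+2).+2)%N by lia.
have -> : (t - m.+1 = (t - m.+2).+1)%N by lia.
by rewrite -!natr1; field.
Qed.

End Levels.

(** * The joint law of the levels in the random model *)

Section Model.
Context {R : realType} {dT} {T : measurableType dT} (P : probability T R).
Variables (d : R) (n : nat) (X : 'I_n -> 'I_n -> T -> R).
Hypothesis d1 : 1 <= d.
Hypothesis n0 : (0 < n)%N.
Hypothesis X_meas : forall i j : 'I_n, (i < j)%N -> measurable_fun setT (X i j).
Hypothesis X_law : forall i j : 'I_n, (i < j)%N ->
  forall B : set R, measurable B -> P (X i j @^-1` B) = exponential_prob 1 B.
Hypothesis X_ind : mutually_independent P
  (fun e : edge_index n => X (sval e).1 (sval e).2).

Let d0 : 0 < d. Proof. exact: lt_le_trans d1. Qed.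
Let nR : 0 < n%:R :> R. Proof. by rewrite ltr0n. Qed.
Let xi (i : edge_index n) := X (sval i).1 (sval i).2.
Let ends (i : edge_index n) : {set 'I_n} := [set (sval i).1; (sval i).2]%SET.

Definition len w (e : {set 'I_n}) : R := edge_len d n (fun i j => X i j w) e.

Lemma edge_length_ge0 (x : R) : 0 <= edge_length d n x.
Proof. exact: powR_ge0. Qed.

Lemma len_ge0 w e : 0 <= len w e.
Proof. by do 2![apply: sumr_ge0 => ? _]; exact: edge_length_ge0. Qed.

Lemma len_ends w i : len w (ends i) = edge_length d n (xi i w).
Proof.
rewrite /len /edge_len /ends /xi; case: i => -[a b] /= ab.
have nab : a != b by apply: contraTneq ab => ->; rewrite ltnn.
rewrite big_setU1 /= ?big_set1; last by rewrite inE.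
rewrite [X in X + _](big_pred1 b); last first.
  move=> j /=; rewrite !inE; apply/andP/eqP => [[/orP[]/eqP-> //]|->].
    by rewrite ltnn.
  by rewrite eqxx orbT.
rewrite [X in _ + X]big1 ?addr0 // => j; rewrite !inE => /andP[/orP[]/eqP->].
  by rewrite ltnNge (ltnW ab).
by rewrite ltnn.
Qed.

Lemma ends_inj : injective ends.
Proof.
case=> -[a b] /= ab [[a' b'] /= ab'] /setP E; apply: val_inj => /=.
have := E a; have := E b; have := E a'; have := E b'; rewrite /ends !inE /=.
rewrite !eqxx !orbT /= => h1 h2 h3 h4.
clear E; move: ab ab'; case/esym/orP: h4 => /eqP e1; case/esym/orP: h3 => /eqP e2; subst.
- by rewrite ltnn.
- by [].
- by move=> ab ab'; have := ltn_trans ab ab'; rewrite ltnn.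
- by rewrite ltnn.
Qed.

Lemma endsP (e : {set 'I_n}) : #|e| = 2%N -> exists i, ends i = e.
Proof.
move=> /eqP/cards2P[a [b [ab ->]]].
wlog lt : a b ab / (a < b)%N => [h|].
  case: (ltngtP a b) => [|ba|/val_inj eab]; first exact: h.
    by rewrite finset.setUC; apply: h => //; rewrite eq_sym.
  by rewrite eab eqxx in ab.
by exists (exist _ (a, b) lt).
Qed.

Lemma card_ends i : #|ends i| = 2%N.
Proof.
case: i => -[a b] /= ab; rewrite /ends cards2 /=.
by case: eqP ab => // ->; rewrite ltnn.
Qed.

Lemma xi_meas i : measurable_fun setT (xi i).
Proof. by case: i => -[a b] ab; exact: X_meas. Qed.

Lemma xi_law i (B : set R) : measurable B -> P (xi i @^-1` B) = exponential_prob 1 B.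
Proof. by case: i => -[a b] ab; exact: X_law. Qed.

Lemma xi_pre i (B : set R) : measurable B -> measurable (xi i @^-1` B).
Proof. by move=> mB; rewrite -[X in measurable X]setTI; exact: xi_meas. Qed.

Lemma edge_length_meas : measurable_fun setT (edge_length d n).
Proof.
apply: (measurableT_comp (f := @powR R ^~ d^-1)); first exact: measurable_powR.
exact: measurable_funM.
Qed.

Lemma edge_length_le_meas y : measurable [set x | edge_length d n x <= y].
Proof.
rewrite -[X in measurable X]setTI.
by apply: (measurable_fun_le (g := cst y)) => //; exact: edge_length_meas.
Qed.

Lemma edge_length_le x y : 0 <= x -> 0 <= y ->
  (edge_length d n x <= y) = (x <= powR y d / n%:R).
Proof.
move=> x0 y0; rewrite ler_pdivlMr // [x * _]mulrC /edge_length.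
have nx : 0 <= n%:R * x by rewrite mulr_ge0.
have E : powR (powR (n%:R * x) d^-1) d = n%:R * x.
  by rewrite -powRrM mulVf ?powRr1 // gt_eqF.
apply/idP/idP => h.
  by rewrite -E ge0_ler_powR ?nnegrE ?powR_ge0 // ltW.
rewrite leNgt; apply/negP => /(gt0_ltr_powR d0).
by rewrite !nnegrE powR_ge0 => /(_ y0 isT); rewrite E ltNge h.
Qed.

(* [powR] is 1 on negative numbers, so [edge_length] is meaningful only on
   nonnegative arguments; the others have probability 0. *)
Lemma prob_len_le i y : 0 <= y ->
  P [set w | edge_length d n (xi i w) <= y] = (1 - expR (- (powR y d / n%:R)))%:E.
Proof.
move=> y0; set z := powR y d / n%:R.
have z0 : 0 <= z by rewrite divr_ge0 ?powR_ge0.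
have mneg : measurable (`]-oo, 0[ : set R) by exact: measurable_itv.
have neg0 : P (xi i @^-1` `]-oo, 0[) = 0%E.
  rewrite xi_law // /exponential_prob; apply: integral0_eq => x /=.
  by rewrite in_itv /= => x0; rewrite lt0_exponential_pdf.
have mid : P (xi i @^-1` `[0, z]) = (1 - expR (- z))%:E.
  rewrite xi_law //; move: z0; rewrite le_eqVlt => /predU1P[<-|z0].
    by rewrite set_itv1 /exponential_prob integral_set1 oppr0 expR0 subrr.
  by rewrite exponential_prob_itv0c // mulN1r.
have mBw := xi_pre i (edge_length_le_meas y).
have m1 : measurable (xi i @^-1` `[0, z]) by exact: xi_pre.
have m2 : measurable (xi i @^-1` `]-oo, 0[) by exact: xi_pre.
rewrite -mid; apply/eqP; rewrite eq_le; apply/andP; split.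
  rewrite -[leRHS]adde0 -neg0; apply: le_trans (measureU2 _ m1 m2).
  rewrite le_measure ?inE //; first exact: measurableU.
  move=> w /= h; case: (ltP (xi i w) 0) => x0; [right|left]; rewrite /= in_itv //=.
  by rewrite x0 -edge_length_le.
rewrite le_measure ?inE // => w /=; rewrite in_itv /= => /andP[x0 xz].
by rewrite edge_length_le.
Qed.


Variables (dl : R) (t : nat).
Hypothesis dl0 : 0 < dl.

(* Subsets that are not edges get the constant 0, so that all of them may serve as
   coordinates of a product measure. *)
Definition lev s w (e : {set 'I_n}) : nat := if #|e| == 2%N then level dl s (len w e) else 0%N.

Lemma lev_lt s w e : (lev s w e < s.+2)%N.
Proof. by rewrite /lev; case: ifP => // _; rewrite ltnS level_le. Qed.

Definition levf w : {ffun {set 'I_n} -> 'I_t.+2} := [ffun e => Ordinal (lev_lt t w e)].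

Lemma wt_levf w : wt (levf w) = lev t w.
Proof. by apply/funext => e; rewrite /wt /levf ffunE. Qed.

Let B a : set R := [set x | level dl t (edge_length d n x) = a].

Lemma level_gt_meas m : measurable [set x | (m < level dl t (edge_length d n x))%N].
Proof.
case: (leqP m t) => mt; last first.
  rewrite [X in measurable X](_ : _ = set0) //; apply/seteqP; split => // x /=.
  by rewrite level_gt // leqNgt mt.
rewrite [X in measurable X](_ : _ = [set x | edge_length d n x <= (t - m)%:R * dl]).
  exact: edge_length_le_meas.
by apply/seteqP; split => x /=; rewrite level_gt // mt.
Qed.

Lemma B_meas a : measurable (B a).
Proof.
case: a => [|a].
  rewrite [X in measurable X](_ : _ = ~` [set x | (0 < level dl t (edge_length d n x))%N]).
    by apply: measurableC; exact: level_gt_meas.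
  apply/seteqP; split => x; rewrite /B /= lt0n; first by move=> ->.
  by move=> /negP; rewrite negbK => /eqP.
rewrite [X in measurable X](_ : _ = [set x | (a < level dl t (edge_length d n x))%N] `\`
    [set x | (a.+1 < level dl t (edge_length d n x))%N]).
  by apply: measurableD; exact: level_gt_meas.
apply/seteqP; split => x; rewrite /B /=; first by move=> ->; rewrite ltnn.
by move=> [h1 /negP]; rewrite -leqNgt => h2; apply/eqP; rewrite eqn_leq h1 h2.
Qed.

Lemma levf_ends i a : [set w | levf w (ends i) = a] = xi i @^-1` B a.
Proof.
have E w : levf w (ends i) = level dl t (edge_length d n (xi i w)) :> nat.
  by rewrite /levf ffunE /= /lev card_ends eqxx len_ends.
apply/seteqP; split=> w /=; rewrite /B /= -E; first by move=> ->.
by move=> h; exact: val_inj.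
Qed.

Lemma levf_eq0 w (e : {set 'I_n}) : #|e| != 2%N -> levf w e = 0%N :> nat.
Proof. by move=> /negbTE e2; rewrite /levf ffunE /= /lev e2. Qed.

Lemma levf_meas1 e a : measurable [set w | levf w e = a].
Proof.
case: (boolP (#|e| == 2%N)) => [/eqP/endsP[i <-]|e2].
  by rewrite levf_ends; apply: xi_pre; exact: B_meas.
case: (eqVneq (a : nat) 0%N) => a0.
  rewrite [X in measurable X](_ : _ = setT) //; apply/seteqP; split => // w _ /=.
  by apply: val_inj; rewrite /= a0 levf_eq0.
rewrite [X in measurable X](_ : _ = set0) //; apply/seteqP; split => // w /=.
by move=> h; rewrite -h levf_eq0 in a0.
Qed.

Definition plev (e : {set 'I_n}) (a : 'I_t.+2) : R := fine (P [set w | levf w e = a]).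

Lemma plevE e a : P [set w | levf w e = a] = (plev e a)%:E.
Proof. by rewrite /plev fineK // fin_num_measure //; exact: levf_meas1. Qed.

Lemma plev_ge0 e a : 0 <= plev e a. Proof. exact: fine_ge0. Qed.

Lemma plev_sum e (A : pred 'I_t.+2) :
  P [set w | A (levf w e)] = (\sum_(a | A a) plev e a)%:E.
Proof.
rewrite (prob_fin P (levf_meas1 e)) -sumEFin.
by apply: eq_bigr => a _; exact: plevE.
Qed.

Lemma plev_sum1 e : \sum_a plev e a = 1.
Proof.
have := plev_sum e xpredT; rewrite (_ : [set _ | _] = setT); last exact/seteqP.
by rewrite probability_setT => -[].
Qed.

Lemma plev_law (e : {set 'I_n}) m : #|e| = 2%N ->
  \sum_(a : 'I_t.+2 | (a <= m)%N) plev e a = expR (- (glev dl d t m / #|'I_n|%:R)).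
Proof.
move=> /endsP[i <-]; apply: EFin_inj.
rewrite -(plev_sum (ends i) (fun a : 'I_t.+2 => (a <= m)%N)) card_ord.
have E w : levf w (ends i) = level dl t (edge_length d n (xi i w)) :> nat.
  by rewrite /levf ffunE /= /lev card_ends eqxx len_ends.
case: (leqP m t) => mt; last first.
  have -> : glev dl d t m = 0 by apply: glev_eq0 => //; exact: ltnW.
  rewrite mul0r oppr0 expR0 -(@probability_setT _ _ _ P); congr (P _).
  apply/seteqP; split=> // w _ /=; rewrite E.
  by apply: leq_trans (level_le dl0 _ _) mt.
pose y := (t - m)%:R * dl.
have y0 : 0 <= y by rewrite mulr_ge0 // ltW.
have -> : [set w | (levf w (ends i) <= m)%N] = ~` [set w | edge_length d n (xi i w) <= y].
  apply/seteqP; split=> w /=; rewrite E leqNgt level_gt // mt /=; by move=> /negP.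
rewrite probability_setC; last exact: (xi_pre i (edge_length_le_meas y)).
by rewrite prob_len_le // -EFinB opprB addrC subrK.
Qed.

(** Independence is given over pairs i < j only; sets that are not edges have the constant level 0
    and contribute a factor 1, or make both sides vanish. *)
Lemma levf_joint f : P [set w | levf w = f] = (\prod_e plev e (f e))%:E.
Proof.
case: (boolP [exists e : {set 'I_n}, (#|e| != 2%N) && (f e != 0%N :> nat)]) => [|/existsPn good].
  move=> /existsP[e /andP[e2 fe]]; rewrite (bigD1 e) //=.
  have E0 : [set w | levf w e = f e] = set0.
    by apply/seteqP; split=> // w /= h; rewrite -h levf_eq0 in fe.
  rewrite /plev E0 measure0 mul0r (_ : [set _ | _] = set0) ?measure0 //.
  by apply/seteqP; split=> // w /= h; rewrite -h levf_eq0 in fe.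
have fgood (e : {set 'I_n}) : #|e| != 2%N -> f e = 0%N :> nat.
  by move=> e2; have := good e; rewrite e2 /= negbK => /eqP.
have -> : \prod_e plev e (f e) = \prod_i plev (ends i) (f (ends i)).
  rewrite (bigID (fun e : {set 'I_n} => #|e| == 2%N)) /= [X in _ * X]big1 ?mulr1; last first.
    move=> e e2; rewrite /plev (_ : [set _ | _] = setT) ?probability_setT //.
    by apply/seteqP; split=> // w _; apply: val_inj; rewrite /= levf_eq0 // fgood.
  have -> : \prod_(e : {set 'I_n} | #|e| == 2%N) plev e (f e) =
      \prod_(e in [set ends i | i in [set: edge_index n]%SET]%SET) plev e (f e).
    apply: eq_bigl => e; apply/eqP/imsetP => [/endsP[i <-]|[i _ ->]].
      by exists i.
    exact: card_ends.
  rewrite big_imset /=; last by move=> i j _ _; exact: ends_inj.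
  by apply: eq_bigl => i; rewrite inE.
have -> : [set w | levf w = f] =
    \bigcap_(i in [set i | i \in [set: edge_index n]%SET]) (xi i @^-1` B (f (ends i))).
  apply/seteqP; split=> [w /= <- i _|w h].
    by have := levf_ends i (levf w (ends i)) => /seteqP[/(_ w)] /(_ erefl).
  apply/ffunP => e; case: (boolP (#|e| == 2%N)) => [/eqP/endsP[i <-]|e2].
    have := h i; rewrite /= finset.in_setT => /(_ isT).
    by have := levf_ends i (f (ends i)) => /seteqP[_ /(_ w)].
  by apply: val_inj; rewrite /= levf_eq0 // fgood.
rewrite X_ind; last by move=> i; exact: B_meas.
rewrite -prodEFin; apply: eq_big => [i|i _]; first by rewrite finset.in_setT.
by rewrite -plevE levf_ends.
Qed.

Lemma levf_meas f : measurable [set w | levf w = f].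
Proof.
rewrite [X in measurable X](_ : _ = \bigcap_(e in [set: {set 'I_n}]) [set w | levf w e = f e]).
  by apply: fin_bigcap_measurable => [|e _]; [exact: finite_finset|exact: levf_meas1].
apply/seteqP; split=> [w /= <- //|w h]; apply/ffunP => e; exact: h.
Qed.

Lemma prob_levf (A : pred {ffun {set 'I_n} -> 'I_t.+2}) :
  P [set w | A (levf w)] = (Ex plev (fun f => (A f)%:R))%:E.
Proof.
rewrite (prob_fin P levf_meas) /Ex -sumEFin big_mkcond /=.
apply: eq_bigr => f _; rewrite levf_joint; case: (A f); rewrite ?mulr1 ?mulr0 //.
Qed.

End Model.

(** * Expansion of the random graph *)

Section Scales.
Context {R : realType}.

Lemma expR_ge_id (x : R) : x <= expR x.
Proof. by have := expR_ge1Dx x; lra. Qed.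

(** With z = s / n, the binomial theorem gives C(n, k) z^k <= (1 + z)^n <= e^s, and z^(-k) <= e^(k /
    z) = e^(k n / s) <= e^s. *)
Lemma bin_le_expR (n k : nat) (s : R) : 0 <= s -> (k * n)%:R <= s ^+ 2 ->
  'C(n, k)%:R <= expR (2 * s).
Proof.
move=> s0 ks; case: (posnP k) => [->|k0].
  by rewrite bin0 -[leLHS]expR0 ler_expR; lra.
case: (posnP n) => [->|n0]; first by rewrite bin0n gtn_eqF ?expR_ge0.
have kR : 0 < k%:R :> R by rewrite ltr0n.
have nR : 0 < n%:R :> R by rewrite ltr0n.
have s_gt0 : 0 < s.
  rewrite lt_neqAle s0 andbT; apply: contraTneq ks => <-.
  by rewrite expr0n -ltNge ltr0n muln_gt0 k0.
pose z := s / n%:R.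
have z0 : 0 < z by rewrite divr_gt0.
have h1 : 'C(n, k)%:R * z ^+ k <= expR s.
  apply: (@le_trans _ _ ((1 + z) ^+ n)).
    case: (leqP k n) => kn; last by rewrite bin_small // mul0r exprn_ge0 // addr_ge0 // ltW.
    rewrite addrC exprD1n; have kn' : (k < n.+1)%N by [].
    rewrite (bigD1 (Ordinal kn')) //= mulr_natl lerDl.
    by apply: sumr_ge0 => i _; rewrite mulrn_wge0 // exprn_ge0 // ltW.
  have -> : s = z * n%:R by rewrite /z divfK // gt_eqF.
  rewrite mulrC expRM_natl ler_pXn2r ?nnegrE ?expR_ge0 ?expR_ge1Dx //.
  by rewrite addr_ge0 // ltW.
have h2 : (z^-1) ^+ k <= expR s.
  apply: (@le_trans _ _ (expR (z^-1) ^+ k)).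
    by rewrite ler_pXn2r ?nnegrE ?expR_ge0 ?invr_ge0 ?(ltW z0) // expR_ge_id.
  rewrite -expRM_natl ler_expR /z invf_div mulrA ler_pdivrMr // -expr2.
  by rewrite -natrM.
have -> : 2 * s = s + s by lra.
have zk : 0 < z ^+ k by rewrite exprn_gt0.
have p1 : 0 <= 'C(n, k)%:R * z ^+ k by rewrite mulr_ge0 // ltW.
have p2 : 0 <= z^-1 ^+ k by rewrite exprVn invr_ge0 ltW.
rewrite expRD; apply: le_trans (ler_pM p1 p2 h1 h2).
by rewrite exprVn mulfK // gt_eqF.
Qed.

(** With fourth roots as the basic quantities, all scales become integer powers accessible to [ring]
    and [field]. *)
Definition root4 (x : nat) : R := Num.sqrt (Num.sqrt x%:R).

Lemma root4_ge0 x : 0 <= root4 x. Proof. exact: sqrtr_ge0. Qed.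

Lemma root4E x : root4 x ^+ 4 = x%:R.
Proof. by rewrite (exprM _ 2 2) !sqr_sqrtr ?sqrtr_ge0. Qed.

Lemma root4_le x y : (x <= y)%N -> root4 x <= root4 y.
Proof. by move=> xy; rewrite !ler_wsqrtr // ler_nat. Qed.

Lemma root4_ge1 x : (0 < x)%N -> 1 <= root4 x.
Proof. by move=> x0; rewrite -[leLHS]sqrtr1 -[in leLHS]sqrtr1; apply: root4_le x0. Qed.

(** For consecutive fourth roots b <= a, 1 = a^4 - b^4 <= 4 a^3 (a - b), so the sum is dominated by
    a telescoping one. *)
Lemma sum_inv_root4 m : \sum_(1 <= x < m.+1) (root4 x ^+ 3)^-1 <= 4 * root4 m.
Proof.
elim: m => [|m IH]; first by rewrite big_geq // mulr_ge0 ?root4_ge0.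
rewrite big_nat_recr //=.
suff h : (root4 m.+1 ^+ 3)^-1 <= 4 * (root4 m.+1 - root4 m) by lra.
have a1 := root4_ge1 (ltn0Sn m); have ab := root4_le (leqnSn m); have b0 := root4_ge0 m.
have e : root4 m.+1 ^+ 4 - root4 m ^+ 4 = 1 by rewrite !root4E -natr1; lra.
move: (root4 m.+1) (root4 m) a1 ab b0 e => a b a1 ab b0 e.
rewrite -[leLHS]mul1r ler_pdivrMr ?exprn_gt0 //; last by lra.
rewrite -[X in X <= _]e; have -> : a ^+ 4 - b ^+ 4 = (a - b) * (a ^+ 3 + a ^+ 2 * b + a * b ^+ 2 + b ^+ 3) by ring.
have -> : 4 * (a - b) * a ^+ 3 = (a - b) * (a ^+ 3 + a ^+ 2 * a + a * a ^+ 2 + a ^+ 3) by ring.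
rewrite ler_wpM2l ?subr_ge0 // !lerD //.
- by rewrite ler_wpM2l ?sqr_ge0.
- by rewrite ler_wpM2l ?ler_pXn2r ?nnegrE //; lra.
- by rewrite ler_pXn2r ?nnegrE //; lra.
Qed.

(** 1024 = 4 * 16^2: two sets of at least (x n)^(1/2) / 16 vertices fail to be linked with
    probability at most exp (- 4 s), s = x^(1/4) n^(3/4), against at most exp (2 s) pairs of
    sets. *)
Definition link_const : R := 1024.
(* (n/x)^(3/4) up to a constant: it is summable over x, and from x vertices a link of
   this length reaches about (x n)^(1/2) others, enough for two such sets to be linked. *)
Definition link_length n x : R := link_const * root4 n ^+ 3 / root4 x ^+ 3.
Definition reach n x : nat := (Num.truncn ((root4 x * root4 n) ^+ 2 / 16)).+1.

Lemma sum_link_length n m : \sum_(1 <= x < m.+1) link_length n x *+ 3 <= 12 * link_const * root4 n ^+ 3 * root4 m.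
Proof.
rewrite sumrMnl -mulr_sumr.
have b0 : 0 <= link_const * root4 n ^+ 3 by rewrite mulr_ge0 ?exprn_ge0 ?root4_ge0.
by have := ler_wpM2l b0 (sum_inv_root4 m); lra.
Qed.

Lemma link_length_ge1 n x : (0 < x <= n)%N -> 1 <= link_length n x.
Proof.
move=> /andP[x0 xn]; have q1 := root4_ge1 x0; have qn := root4_le xn.
have q3 : 0 < root4 x ^+ 3 by rewrite exprn_gt0 //; lra.
rewrite /link_length ler_pdivlMr // mul1r.
have : root4 x ^+ 3 <= root4 n ^+ 3 by rewrite ler_pXn2r ?nnegrE ?root4_ge0.
by rewrite /link_const; lra.
Qed.

(** For n >= 256 the quantity (x n)^(1/2) / 16 is at least 1 and absorbs the rounding up in
    [reach]. *)
Lemma reachP n x : (256 <= n)%N -> (0 < x)%N ->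
  (root4 x * root4 n) ^+ 2 / 16 <= (reach n x)%:R <= (root4 x * root4 n) ^+ 2 / 8.
Proof.
move=> n256 x0; set r := (root4 x * root4 n) ^+ 2.
have r16 : 16 <= r.
  have q1 := root4_ge1 x0.
  have : 16 <= root4 n ^+ 2.
    rewrite /root4 sqr_sqrtr ?sqrtr_ge0 // -[leLHS](@ger0_norm R) // -sqrtr_sqr ler_wsqrtr //.
    by rewrite -natrX ler_nat.
  have : 1 <= root4 x ^+ 2 by rewrite exprn_ege1.
  by rewrite /r exprMn => h1 h2; rewrite -[leLHS]mul1r ler_pM.
have r0 : 0 <= r / 16 by lra.
have /andP[h1 h2] := truncn_itv r0.
rewrite /reach -/r (ltW h2) /= -natr1; lra.
Qed.

End Scales.

Lemma card_pairs (U : finType) (A B : {set U}) : [disjoint A & B]%B ->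
  #|[set [set x; y]%SET | x in A, y in B]%SET| = (#|A| * #|B|)%N.
Proof.
move=> AB; rewrite curry_imset2X card_in_imset ?cardsX //.
move=> [x y] [x' y']; rewrite !inE /= => /andP[xA yB] /andP[x'A y'B] /setP E.
have no u v : u \in A -> v \in B -> u != v.
  by move=> uA; apply: contraTneq => <-; rewrite (disjointFr AB uA).
have := E x; have := E y; rewrite !inE !eqxx /= orbT.
rewrite (negbTE (no _ _ xA y'B)) orbF [y == x']eq_sym (negbTE (no _ _ x'A yB)) /=.
by move=> /esym/eqP -> /esym/eqP ->.
Qed.

(** * Union bounds over vertex sets that are far apart *)

Section FarApart.
Context {R : realType} {dT} {T : measurableType dT} (P : probability T R).
Variables (d : R) (n : nat) (X : 'I_n -> 'I_n -> T -> R).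
Hypothesis d1 : 1 <= d.
Hypothesis n0 : (0 < n)%N.
Hypothesis X_meas : forall i j : 'I_n, (i < j)%N -> measurable_fun setT (X i j).
Hypothesis X_law : forall i j : 'I_n, (i < j)%N ->
  forall B : set R, measurable B -> P (X i j @^-1` B) = exponential_prob 1 B.
Hypothesis X_ind : mutually_independent P
  (fun e : edge_index n => X (sval e).1 (sval e).2).

Notation xi i := (X (sval i).1 (sval i).2).
Notation ends i := [set (sval i).1; (sval i).2]%SET.
Implicit Types (A B Z : {set 'I_n}).

Definition far A B (t : R) : set T :=
  [set w | forall x y, x \in A -> y \in B -> t < len d X w [set x; y]%SET].

Let edges A B : {set edge_index n} :=
  [set i | ends i \in [set [set x; y]%SET | x in A, y in B]]%SET.

Lemma farE A B t : [disjoint A & B]%B -> far A B t =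
  \bigcap_(i in [set i | i \in edges A B]) (xi i @^-1` [set x | t < edge_length d n x]).
Proof.
move=> AB; apply/seteqP; split=> [w h i /=|w h x y xA yB].
  by rewrite inE -len_ends => /imset2P[x y xA yB ->]; exact: h.
have xy : x != y by apply: contraTneq yB => <-; rewrite (disjointFr AB xA).
have [i ei] : exists i : edge_index n, ends i = [set x; y]%SET by apply: endsP; rewrite cards2 xy.
rewrite -ei len_ends; apply: h => /=; rewrite inE ei.
by apply/imset2P; exists x y.
Qed.

Lemma longer_meas t : measurable [set x | t < edge_length d n x].
Proof.
have -> : [set x | t < edge_length d n x] = ~` [set x | edge_length d n x <= t].
  by apply/seteqP; split=> x /=; rewrite ltNge => /negP.
by apply: measurableC; exact: edge_length_le_meas.
Qed.

Lemma far_meas A B t : [disjoint A & B]%B -> measurable (far A B t).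
Proof.
move=> AB; rewrite farE //; apply: fin_bigcap_measurable; first exact: finite_finset.
by move=> i _; apply: xi_pre => //; exact: longer_meas.
Qed.

Lemma prob_longer (i : edge_index n) t : 0 <= t ->
  P (xi i @^-1` [set x | t < edge_length d n x]) = (expR (- (powR t d / n%:R)))%:E.
Proof.
move=> t0; have -> : xi i @^-1` [set x | t < edge_length d n x] =
    ~` [set w | edge_length d n (xi i w) <= t].
  by apply/seteqP; split=> w /=; rewrite ltNge => /negP.
rewrite probability_setC; last exact: (xi_pre X_meas i (edge_length_le_meas d n t)).
by rewrite (prob_len_le d1 n0 X_meas X_law) // -EFinB opprB addrC subrK.
Qed.

(** For t >= 1 one has t <= t^d, so a single linear exponent serves every d >= 1. *)
Lemma prob_far A B t : [disjoint A & B]%B -> 1 <= t ->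
  (P (far A B t) <= (expR (- ((#|A| * #|B|)%:R * t / n%:R)))%:E)%E.
Proof.
move=> AB t1; have t0 : 0 <= t by lra.
rewrite farE // X_ind; last by move=> _; exact: longer_meas.
under eq_bigr do rewrite prob_longer //.
rewrite prodEFin lee_fin prodr_const -expRM_natl ler_expR.
have -> : #|edges A B| = (#|A| * #|B|)%N.
  rewrite -(card_pairs AB) -(card_imset _ (@ends_inj n)).
  apply: eq_card => e; apply/imsetP/idP => [[i]|]; first by rewrite inE => h ->.
  move=> /imset2P[x y xA yB ->].
  have xy : x != y by apply: contraTneq yB => <-; rewrite (disjointFr AB xA).
  have [i ei] : exists i : edge_index n, ends i = [set x; y]%SET by apply: endsP; rewrite cards2 xy.
  by exists i; rewrite // inE ei; apply/imset2P; exists x y.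
have tt : t <= powR t d by apply: le1r_powR.
rewrite mulrN lerN2 -mulrA ler_wpM2l // ler_wpM2r ?invr_ge0 //.
Qed.


Notation y x := (@reach R n x).
Notation lm x := (@link_length R n x).

Definition sparse_set x : set T :=
  \big[setU/set0]_(A : {set 'I_n} | #|A| == x)
    \big[setU/set0]_(Z : {set 'I_n} | #|Z| == (2 * y x)%N) far A (~: (A :|: Z))%SET (lm x).

Definition sparse_pair x : set T :=
  \big[setU/set0]_(A : {set 'I_n} | #|A| == y x)
    \big[setU/set0]_(B : {set 'I_n} | (#|B| == y x) && [disjoint A & B]%B) far A B (lm x).

Lemma disjointCU A Z : [disjoint A & (~: (A :|: Z))%SET]%B.
Proof.
by rewrite disjoint_subset; apply/fintype.subsetP => u uA; rewrite !inE uA.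
Qed.

Lemma sparse_set_meas x : measurable (sparse_set x).
Proof.
by do 2![apply: bigsetU_measurable => ? _]; apply: far_meas; exact: disjointCU.
Qed.

Lemma sparse_pair_meas x : measurable (sparse_pair x).
Proof.
apply: bigsetU_measurable => A _; apply: bigsetU_measurable => B /andP[_ AB].
exact: far_meas.
Qed.

Lemma double_union_le (a b : nat) (Q : {set 'I_n} -> pred {set 'I_n}) F (c : R) :
  0 <= c ->
  (forall A B, Q A B -> #|B| == b) ->
  (forall A B, #|A| == a -> Q A B -> measurable (F A B : set T)) ->
  (forall A B, #|A| == a -> Q A B -> (P (F A B) <= c%:E)%E) ->
  (P (\big[setU/set0]_(A : {set 'I_n} | #|A| == a) \big[setU/set0]_(B | Q A B) F A B)
    <= ('C(n, a)%:R * ('C(n, b)%:R * c))%:E)%E.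
Proof.
move=> c0 hQ mF hF.
have cs k : \sum_(A : {set 'I_n} | #|A| == k) 1 = 'C(n, k)%:R :> R.
  by rewrite sumr_const -[in RHS](card_ord n) -card_draws cardsE.
apply: le_trans (measure_bigsetU_le P _ _) _.
  by move=> A Aa; apply: bigsetU_measurable => B; exact: mF.
apply: (@le_trans _ _ (\sum_(A : {set 'I_n} | #|A| == a) ('C(n, b)%:R * c)%:E)%E); last first.
  by rewrite sumEFin lee_fin -(cs a) mulr_suml ler_sum // => A _; rewrite mul1r.
apply: lee_sum => A Aa; apply: le_trans (measure_bigsetU_le P _ _) _.
  by move=> B; exact: mF.
apply: (@le_trans _ _ (\sum_(B : {set 'I_n} | Q A B) c%:E)%E).
  by apply: lee_sum => B; exact: hF.
rewrite sumEFin lee_fin -(cs b) mulr_suml big_mkcond [leRHS]big_mkcond /=.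
apply: ler_sum => B _; case: ifP => [/hQ ->|_]; first by rewrite mul1r.
by case: ifP; rewrite ?mul1r.
Qed.

Hypothesis n256 : (256 <= n)%N.

Section FixedSize.
Variable x : nat.
Hypothesis x0 : (0 < x)%N.
Hypothesis xn : (x <= n./2)%N.

Let q : R := root4 x.
Let b : R := root4 n.
Let xle : (x <= n)%N. Proof. by move: xn; rewrite geq_half_double -addnn; exact: leq_trans (leq_addr _ _). Qed.
Let q1 : 1 <= q. Proof. exact: root4_ge1. Qed.
Let qb : q <= b. Proof. exact: root4_le. Qed.
Let q_gt0 : 0 < q. Proof. exact: lt_le_trans q1. Qed.
Let b_gt0 : 0 < b. Proof. exact: lt_le_trans qb. Qed.
Let s_ge0 : 0 <= q * b ^+ 3.
Proof. exact: mulr_ge0 (ltW q_gt0) (exprn_ge0 _ (ltW b_gt0)). Qed.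
Let nE : n%:R = b ^+ 4 :> R. Proof. by rewrite root4E. Qed.
Let xE : x%:R = q ^+ 4 :> R. Proof. by rewrite root4E. Qed.
Let yle : (y x)%:R <= (q * b) ^+ 2 / 8. Proof. by have /andP[] := @reachP R n x n256 x0. Qed.
Let yge : (q * b) ^+ 2 / 16 <= (y x)%:R. Proof. by have /andP[] := @reachP R n x n256 x0. Qed.
Let lmE : lm x = link_const * b ^+ 3 / q ^+ 3. Proof. by []. Qed.
Let lm1 : 1 <= lm x. Proof. by apply: link_length_ge1; rewrite x0 xle. Qed.
Let x2n : x%:R <= n%:R / 2 :> R.
Proof. by rewrite ler_pdivlMr // -natrM ler_nat muln2 -geq_half_double. Qed.

Let qb3 : (q * b) ^+ 2 <= q * b ^+ 3.
Proof.
have -> : q * b ^+ 3 = (q * b ^+ 2) * b by ring.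
have -> : (q * b) ^+ 2 = (q * b ^+ 2) * q by ring.
by rewrite ler_wpM2l // mulr_ge0 ?sqr_ge0 // ltW.
Qed.

Let qb4 : (q * b) ^+ 2 <= n%:R.
Proof.
by rewrite nE; apply: le_trans qb3 _; rewrite (exprS b 3) ler_wpM2r ?exprn_ge0 // ltW.
Qed.

Lemma two_reach : (2 * y x <= n)%N.
Proof. by rewrite -(ler_nat R) natrM; have := sqr_ge0 (q * b); have := yle; have := qb4; lra. Qed.

Lemma bin_y k : k%:R <= (q * b) ^+ 2 / 4 -> 'C(n, k)%:R <= expR (q * b ^+ 3).
Proof.
move=> hk; have -> : q * b ^+ 3 = 2 * (q * b ^+ 3 / 2) by field.
apply: bin_le_expR; first by rewrite divr_ge0.
rewrite natrM nE; have -> : (q * b ^+ 3 / 2) ^+ 2 = (q * b) ^+ 2 / 4 * b ^+ 4 by field.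
by rewrite ler_wpM2r // exprn_ge0 // ltW.
Qed.

Lemma prob_sparse_set : (P (sparse_set x) <= (expR (- (q * b ^+ 3)))%:E)%E.
Proof.
pose c := expR (- (256 * (q * b ^+ 3))) : R.
apply: le_trans (double_union_le (c := c) (b := (2 * y x)%N) _ _ _ _) _.
- exact: expR_ge0.
- by [].
- by move=> A Z _ _; apply: far_meas => //; exact: disjointCU.
- move=> A Z /eqP cA /eqP cZ; apply: le_trans (prob_far (disjointCU A Z) lm1) _.
  rewrite lee_fin ler_expR lerN2 cA natrM.
  (* Here |A| <= n/2 and |Z| <= n/4 because y <= n/8. *)
  have big : n%:R / 4 <= #|(~: (A :|: Z))%SET|%:R :> R.
    have : (n <= #|(~: (A :|: Z))%SET| + (#|A| + #|Z|))%N.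
      rewrite -{1}(card_ord n) -(cardsC (A :|: Z)%SET) addnC leq_add2l.
      by rewrite -cardsUI leq_addr.
    by rewrite cA cZ -(ler_nat R) !natrD natrM; have := sqr_ge0 (q * b); have := yle; have := qb4; have := x2n; lra.
  have -> : 256 * (q * b ^+ 3) = x%:R * (n%:R / 4) * lm x / n%:R.
    rewrite lmE xE nE /link_const; field.
    by apply/andP; split; rewrite gt_eqF.
  by rewrite ler_wpM2r ?invr_ge0 // ler_wpM2r ?ler_wpM2l // (le_trans _ lm1).
rewrite lee_fin /c.
have h1 : 'C(n, x)%:R <= expR (2 * (q * b ^+ 3)).
  apply: bin_le_expR; first exact: s_ge0.
  rewrite natrM xE nE; have -> : q ^+ 4 * b ^+ 4 = ((q * b) ^+ 2) ^+ 2 by ring.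
  by rewrite ler_pXn2r ?nnegrE ?sqr_ge0 ?(le_trans _ qb3) ?sqr_ge0.
have h2 : 'C(n, 2 * y x)%:R <= expR (q * b ^+ 3).
  by apply: bin_y; rewrite natrM; have := yle; lra.
set s := q * b ^+ 3 in h1 h2 *.
have s0 : 0 <= s by exact: s_ge0.
have -> : - s = 2 * s + (s + (- (4 * s))) by ring.
rewrite !expRD ler_pM ?mulr_ge0 ?expR_ge0 // ler_pM ?expR_ge0 // ler_expR; lra.
Qed.

Lemma prob_sparse_pair : (P (sparse_pair x) <= (expR (- (q * b ^+ 3)))%:E)%E.
Proof.
pose c := expR (- (4 * (q * b ^+ 3))) : R.
apply: le_trans (double_union_le (c := c) (b := y x) _ _ _ _) _.
- exact: expR_ge0.
- by move=> A B /andP[].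
- by move=> A B _ /andP[_ AB]; apply: far_meas.
- move=> A B /eqP cA /andP[/eqP cB AB].
  apply: le_trans (prob_far AB lm1) _.
  rewrite lee_fin ler_expR lerN2 cA cB natrM.
  have -> : 4 * (q * b ^+ 3) = ((q * b) ^+ 2 / 16) * ((q * b) ^+ 2 / 16) * lm x / n%:R.
    rewrite lmE nE /link_const; field.
    by apply/andP; split; rewrite gt_eqF.
  rewrite ler_wpM2r ?invr_ge0 // ler_wpM2r ?(le_trans _ lm1) //.
  by rewrite ler_pM // divr_ge0 ?sqr_ge0.
rewrite lee_fin /c.
have h : 'C(n, y x)%:R <= expR (q * b ^+ 3).
  by apply: bin_y; have := yle; have := sqr_ge0 (q * b); lra.
set s := q * b ^+ 3 in h *.
have s0 : 0 <= s by exact: s_ge0.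
have -> : - s = s + (s + (- (3 * s))) by ring.
rewrite !expRD ler_pM ?mulr_ge0 ?expR_ge0 // ler_pM ?expR_ge0 // ler_expR; lra.
Qed.

Lemma expanding_of_not_sparse w : ~ sparse_set x w -> ~ sparse_pair x w ->
  expanding (len d X w) x (y x) (lm x).
Proof.
move=> ns np; split; first by rewrite card_ord two_reach.
  move=> A Z cA cZ; apply: contrapT => no; apply: ns.
  apply/bigsetUP; exists A; split; [exact: mem_index_enum|exact/eqP|].
  apply/bigsetUP; exists Z; split; [exact: mem_index_enum|exact/eqP|].
  move=> u v uA vZ; rewrite ltNge; apply/negP => luv; apply: no; exists u, v.
  by split => //; move: vZ; rewrite finset.in_setC.
move=> A B cA cB AB; apply: contrapT => no; apply: np.
apply/bigsetUP; exists A; split; [exact: mem_index_enum|exact/eqP|].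
apply/bigsetUP; exists B; split; [exact: mem_index_enum| |].
  by rewrite cB eqxx.
move=> u v uA vB; rewrite ltNge; apply/negP => luv; apply: no; exists u, v.
by split.
Qed.

End FixedSize.

Lemma expansion_event : exists bad : set T, [/\ measurable bad,
  (P bad <= (512 / n%:R)%:E)%E &
  forall w, ~ bad w -> forall x, (0 < x <= n./2)%N ->
    expanding (len d X w) x (y x) (lm x)].
Proof.
pose good x := (0 < x <= n./2)%N.
pose bad := \big[setU/set0]_(x <- iota 0 n | good x) (sparse_set x `|` sparse_pair x).
have mb x : good x -> measurable (sparse_set x `|` sparse_pair x).
  by move=> _; apply: measurableU; [exact: sparse_set_meas|exact: sparse_pair_meas].
exists bad; split; first exact: bigsetU_measurable.
  apply: le_trans (measure_bigsetU_le P _ mb) _.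
  pose b : R := root4 n.
  apply: (@le_trans _ _ (\sum_(x <- iota 0 n | good x) (2 * expR (- (b ^+ 2)))%:E)%E).
    apply: lee_sum => x /andP[x0 xn].
    apply: le_trans (measureU2 _ (sparse_set_meas x) (sparse_pair_meas x)) _.
    have -> : 2 * expR (- (b ^+ 2)) = expR (- (b ^+ 2)) + expR (- (b ^+ 2)) by ring.
    have h : ((expR (- (root4 x * b ^+ 3)))%:E <= (expR (- (b ^+ 2)))%:E)%E.
      rewrite lee_fin ler_expR lerN2 (exprS b 2) mulrA ler_peMl ?sqr_ge0 //.
      by rewrite mulr_ege1 // root4_ge1.
    rewrite EFinD; apply: leeD; apply: le_trans h.
      exact: prob_sparse_set.
    exact: prob_sparse_pair.
  rewrite sumEFin lee_fin; apply: (@le_trans _ _ (\sum_(x <- iota 0 n) 2 * expR (- (b ^+ 2)))).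
    have c0 : 0 <= 2 * expR (- (b ^+ 2)) by rewrite mulr_ge0 ?expR_ge0.
    by rewrite [leLHS]big_mkcond; apply: ler_sum => x _; case: ifP.
  have -> : iota 0 n = index_iota 0 n by rewrite /index_iota subn0.
  rewrite sumr_const_nat subn0 -[leLHS]mulr_natl.
  have nE : n%:R = b ^+ 4 :> R by rewrite root4E.
  have b0 : 0 < b by apply: lt_le_trans (root4_ge1 n0).
  (* This says exp (n^(1/2)) >= n^2 / 256, so that n terms 2 exp (- n^(1/2)) sum to at most 512 /
     n. *)
  have ub : (b ^+ 2 / 4) ^+ 4 <= expR (b ^+ 2).
    have -> : expR (b ^+ 2) = expR (b ^+ 2 / 4) ^+ 4.
      by rewrite -expRM_natl; congr expR; field.
    rewrite ler_pXn2r ?nnegrE ?expR_ge0 ?expR_ge_id //.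
    by rewrite divr_ge0 ?sqr_ge0.
  have e0 := expR_gt0 (b ^+ 2).
  rewrite expRN ler_pdivlMr ?ltr0n // nE.
  have -> : b ^+ 4 * (2 / expR (b ^+ 2)) * b ^+ 4 =
      512 * ((b ^+ 2 / 4) ^+ 4 / expR (b ^+ 2)) by field; rewrite gt_eqF.
  apply: ler_piMr; first exact: ler0n.
  by rewrite ler_pdivrMr // mul1r.
move=> w nb x gx; have /andP[x0 xn] := gx.
have nx : ~ (sparse_set x `|` sparse_pair x) w.
  move=> h; apply: nb; apply/bigsetUP; exists x; split=> //.
  by rewrite mem_iota; lia.
by apply: expanding_of_not_sparse => // h; apply: nx; [left|right].
Qed.

End FarApart.

Definition iid_model {R : realType} {dT} {T : measurableType dT} (P : probability T R)
    (n : nat) (X : 'I_n -> 'I_n -> T -> R) : Prop :=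
  [/\ forall i j : 'I_n, (i < j)%N -> measurable_fun setT (X i j),
      forall i j : 'I_n, (i < j)%N -> forall B : set R, measurable B ->
        P (X i j @^-1` B) = exponential_prob 1 B
    & mutually_independent P (fun e : edge_index n => X (sval e).1 (sval e).2)].

(* mu is the asymptotic proportion of vertices covered at level t. *)
Lemma level_event (R : realType) (d dl eps : R) (t : nat) : 1 <= d -> 0 < dl -> 0 < eps ->
  exists mu C : R, [/\ 0 <= mu <= 1, 0 <= C &
  forall dT (T : measurableType dT) (P : probability T R) n (X : 'I_n -> 'I_n -> T -> R),
    (0 < n)%N -> iid_model P X ->
    exists bad : set T, [/\ measurable bad, (P bad <= (C / n%:R)%:E)%E &
      forall w, ~ bad w -> forall m, optimal (lev d X dl t w) m ->
        n%:R * (mu - eps) <= (2 * #|m|)%:R <=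
        n%:R * (mu + 2 * (glev dl d t 0 - glev dl d t 1) + 2 * eps)]].
Proof.
move=> d1 dl0 eps0; set g := glev dl d t; pose c m := g m - g m.+1.
have g_noninc m : g m.+1 <= g m by exact: glev_noninc.
have g_eq0 m : (t <= m)%N -> g m = 0 by exact: glev_eq0.
have c_ge0 m : 0 <= c m by rewrite subr_ge0.
have c_noninc m : c m.+1 <= c m by exact: glev_convex.
have c_eq0 m : (t <= m)%N -> c m = 0.
  by move=> tm; rewrite /c !g_eq0 ?subrr // ltnW.
have [r rev HK] := Hlim_Klim c_ge0 c_noninc c_eq0 eps0.
pose C := (concC t g r 0 + stuckB t g r (concC t g r 2) 0) / eps ^+ 2.
(* [mu] is the limit of the lower bound at the even depth [r]; by [HK] the upper bound exceeds it by
   at most 2 c 0 + eps, and concentration adds another eps. *)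
exists (1 - Hlim t c r 0), `|C|; split=> //.
  by have := Hlim_le1 t c_ge0 r 0; have := Hlim_ge0 t c r 0; lra.
move=> dT T P n X n0 [Xm Xl Xi].
exists [set w | ~~ typical t g r eps (levf d X t dl0 w)]; split.
- apply: (@measurable_fin _ _ _ (levf d X t dl0) _ (fun f => ~~ typical t g r eps f)).
  exact: levf_meas.
- rewrite (prob_levf d Xm Xi dl0 (fun f => ~~ typical t g r eps f)) lee_fin.
  apply: (@le_trans _ _ (C / n%:R)); last by rewrite ler_wpM2r ?invr_ge0 // ler_norm.
  rewrite (_ : n%:R = #|'I_n|%:R :> R); last by rewrite card_ord.
  apply: Ex_typical => //.
  + exact: plev_ge0.
  + exact: plev_sum1.
  + by rewrite card_ord.
  + by move=> e m; exact: plev_law.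
- move=> w /= /negP; rewrite negbK => /forallP typ m opt.
  have := typ m; rewrite wt_levf opt /= card_ord => /andP[lo up].
  apply/andP; split=> //; apply: le_trans up _; rewrite ler_wpM2l //.
  by rewrite -/c -/(c 0%N); lra.
Qed.

(** * From truncated to perfect matchings *)

Section Assembly.
Context {R : realType} {n : nat}.
Variables (l : {set 'I_n} -> R) (dl : R).
Hypothesis l0 : forall e, 0 <= l e.
Hypothesis dl0 : 0 < dl.

(** Deterministic form of [lev], for one fixed realisation of the lengths. *)
Definition lvl s (e : {set 'I_n}) : nat := if #|e| == 2%N then level dl s (l e) else 0%N.

Let W s := maxW (excess (lvl s)) [set: 'I_n]%SET.

Lemma lvl_gt s (e : {set 'I_n}) m : #|e| = 2%N -> (m < lvl s e)%N = (m <= s)%N && (l e <= (s - m)%:R * dl).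
Proof. by move=> e2; rewrite /lvl e2 eqxx level_gt. Qed.

Lemma lvlS s e : (0 < lvl s e)%N -> lvl s.+1 e = (lvl s e).+1.
Proof.
rewrite /lvl; case: ifP => // e2; rewrite levelS level_gt // subn0 /= => le_s.
rewrite (_ : l e <= s.+1%:R * dl) ?addn1 //; apply: le_trans le_s _.
by rewrite ler_wpM2r ?ler_nat // ltW.
Qed.

Lemma lvl_leS s e : (lvl s.+1 e <= (lvl s e).+1)%N.
Proof. by rewrite /lvl; case: ifP => // _; rewrite levelS -[leqRHS]addn1 leq_add2l leq_b1. Qed.

Lemma maxW_level0 : W 0 = 0%N.
Proof.
have [m [_ _ defW]] := maxW_ex (excess (lvl 0)) [set: 'I_n]%SET; rewrite /W -defW.
apply: big1 => e _; rewrite /excess /lvl; case: ifP => // _.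
by have := level_le dl0 0 (l e); case: (level _ _ _) => [|[]].
Qed.

(** An optimal matching at level s competes at level s + 1, where each of its edges weighs one unit
    more. *)
Lemma maxW_levelS_ge s m : optimal (lvl s) m -> (W s + #|m| <= W s.+1)%N.
Proof.
case/and3P=> mm /eqP WE /forall_inP pos; rewrite {1}/W -WE -sum1_card -big_split /=.
rewrite (eq_bigr (excess (lvl s.+1))); first exact: maxW_ge (finset.subsetT _).
by move=> e /pos h; rewrite /excess lvlS //= addn1 prednK.
Qed.

(** Conversely an optimal matching at level s + 1 competes at level s, where no edge loses more than
    one unit. *)
Lemma maxW_levelS_le s m : optimal (lvl s.+1) m -> (W s.+1 <= W s + #|m|)%N.
Proof.
case/and3P=> mm /eqP; rewrite -/(W s.+1) => <- _.
apply: (@leq_trans (\sum_(e in m) (excess (lvl s) e + 1))).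
  by apply: leq_sum => e _; rewrite /excess; have := lvl_leS s e; lia.
rewrite big_split /= sum1_card leq_add2r; exact: maxW_ge (finset.subsetT _).
Qed.

(** Every edge satisfies excess >= D - 1 - l / dl, the 1 being the loss from rounding; edges longer
    than the cutoff only help. *)
Lemma perfect_cost_lower D m : matching m ->
  dl * ((D%:R - 1) * #|m|%:R - (W D)%:R) <= mcost l m.
Proof.
move=> mm.
have : \sum_(e in m) (D%:R - 1 - l e / dl) <= (W D)%:R.
  apply: (@le_trans _ _ (\sum_(e in m) (excess (lvl D) e)%:R)); last first.
    by rewrite -natr_sum ler_nat; exact: maxW_ge (finset.subsetT _).
  apply: ler_sum => e em; have e2 := matching_card2 mm em.
  apply: (@le_trans _ _ ((lvl D e)%:R - 1)); last first.
    by rewrite /excess; case: (lvl D e) => [|k]; rewrite /= ?sub0r ?lerN10 // -natr1 addrK.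
  have d_le : l e / dl * dl = l e by rewrite divfK // gt_eqF.
  have ld : 0 <= l e / dl by rewrite divr_ge0 // ltW.
  case: (leqP (lvl D e) D) => h; last first.
    have : D%:R <= (lvl D e)%:R :> R by rewrite ler_nat ltnW.
    by lra.
  have := lvl_gt D (lvl D e) e2; rewrite ltnn h /= => /esym/negbT; rewrite -ltNge.
  by rewrite -ltr_pdivlMr // natrB //; lra.
rewrite sumrB sumr_const -mulr_natr -mulr_suml -/(mcost l m) => h.
have := ler_wpM2l (ltW dl0) h; rewrite mulrBr mulrCA divff ?gt_eqF // mulr1.
by rewrite mulrBr; lra.
Qed.

Lemma optimal_cost_upper D m : optimal (lvl D) m ->
  mcost l m <= dl * (D%:R * #|m|%:R - (W D)%:R).
Proof.
case/and3P=> mm /eqP WE /forall_inP pos.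
apply: (@le_trans _ _ (\sum_(e in m) dl * (D%:R - (excess (lvl D) e)%:R))); last first.
  by rewrite -mulr_sumr sumrB sumr_const -[D%:R *+ _]mulr_natr -natr_sum WE.
apply: ler_sum => e em; have e2 := matching_card2 mm em.
have := lvl_gt D (excess (lvl D) e) e2; rewrite /excess ltn_predL pos // => /esym/andP[h].
by rewrite natrB // mulrC.
Qed.

Lemma maxW_level_le D m : optimal (lvl D) m -> (W D <= D * #|m|)%N.
Proof.
case/and3P=> mm /eqP; rewrite -/(W D) => <- _; rewrite mulnC -sum_nat_const.
apply: leq_sum => e _; rewrite /excess /lvl; case: ifP => // _.
by have := level_le dl0 D (l e); lia.
Qed.


Section Sandwich.
Variables (d eps : R) (D : nat) (mu : nat -> R).
Hypothesis d1 : 1 <= d.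
Hypothesis eps0 : 0 < eps.
Hypothesis D0 : (0 < D)%N.
Hypothesis n0 : (0 < n)%N.
Hypothesis mu_itv : forall t, 0 <= mu t <= 1.
Hypothesis near_mu : forall t m, (t <= D)%N -> optimal (lvl t) m ->
  n%:R * (mu t - eps) <= (2 * #|m|)%:R <=
  n%:R * (mu t + 2 * (glev dl d t 0 - glev dl d t 1) + 2 * eps).

Let S := \sum_(t < D) mu t.
Let theta := D%:R * dl.
(** Riemann sum, over the lengths up to [theta], of half the proportion of free vertices. *)
Let beta := dl * (D%:R - S) / 2.

Lemma maxW_level_ge_mu : n%:R * (S - D%:R * eps) <= 2 * (W D)%:R.
Proof.
suff h k : (k <= D)%N -> n%:R * (\sum_(t < k) mu t - k%:R * eps) <= 2 * (W k)%:R by exact: h.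
elim: k => [_|k IH kD]; first by rewrite big_ord0 mul0r subrr mulr0 mulr_ge0.
have [m opt] := optimal_ex (lvl k).
have /andP[lo _] := near_mu (ltnW kD) opt.
have := maxW_levelS_ge opt; rewrite -(ler_nat R) natrD => h.
have := IH (ltnW kD); rewrite big_ord_recr /= -natr1; rewrite natrM in lo.
by move: lo h; rewrite !mulrDr !mulrN; lra.
Qed.

(** The mesh errors of the levels telescope to 2 theta^d. The 1 pays for summing mu(1), ..., mu(D)
    instead of mu(0), ..., mu(D - 1). *)
Lemma maxW_level_le_mu : 2 * (W D)%:R <= n%:R * (S + 1 + 2 * powR theta d + 2 * D%:R * eps).
Proof.
have h k : (k <= D)%N -> 2 * (W k)%:R <=
    n%:R * (\sum_(t < k) mu t.+1 + 2 * powR (k%:R * dl) d + 2 * k%:R * eps).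
  elim: k => [_|k IH kD].
    by rewrite maxW_level0 big_ord0 !mulr0n !mulr0 !mul0r addr0 add0r !mulr_ge0 ?powR_ge0.
  have [m opt] := optimal_ex (lvl k.+1).
  have /andP[_ up] := near_mu kD opt.
  have := maxW_levelS_le opt; rewrite -(ler_nat R) natrD => hW.
  have := IH (ltnW kD); rewrite big_ord_recr /=.
  rewrite natrM /glev subn0 subSS subn0 in up.
  move: (powR (k.+1%:R * dl) d) (powR (k%:R * dl) d) up => p p' up.
  by rewrite -natr1; move: up hW; rewrite !mulrDr !mulrN; lra.
apply: le_trans (h D (leqnn D)) _; rewrite ler_wpM2l // !lerD2r.
have [D' DE] : exists k, D = k.+1 by exists D.-1; rewrite prednK.
rewrite /S DE big_ord_recr [X in _ <= X + 1]big_ord_recl /=.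
have /andP[m0 _] := mu_itv 0; have /andP[_ m1] := mu_itv D'.+1.
suff -> : \sum_(i < D') mu i.+1 = \sum_(i < D') mu (bump 0 i) by lra.
by apply: eq_bigr.
Qed.

Lemma perfect_ge m : matching m -> (2 * #|m|)%N = n ->
  n%:R * (beta - dl - dl * powR theta d - theta * eps) <= mcost l m.
Proof.
move=> mm m2; apply: le_trans (perfect_cost_lower D mm).
have mE : #|m|%:R = n%:R / 2 :> R by have := congr1 (fun k => k%:R : R) m2; rewrite /= natrM; lra.
have := ler_wpM2l (ltW dl0) maxW_level_le_mu; rewrite mE /beta /theta.
by move: (powR _ _) => p; lra.
Qed.

Hypothesis dl1 : dl <= 1.
Hypothesis n_even : ~~ odd n.
Hypothesis expand : forall x, (0 < x <= n./2)%N ->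
  expanding l x (@reach R n x) (@link_length R n x).

Let C1 : R := 12 * link_const.

Lemma complete_matching m : matching m -> exists m', [/\ matching m', (2 * #|m'|)%N = n &
  mcost l m' <= mcost l m + C1 * root4 n ^+ 3 * root4 (n./2 - #|m|)].
Proof.
move=> mm; have m2 : (2 * #|m| <= n)%N.
  by rewrite -[leqRHS]card_ord card_matching_le.
have nh : (2 * n./2 = n)%N by rewrite mul2n even_halfK.
have cT : #|'I_n| = (2 * (#|m| + (n./2 - #|m|)))%N by rewrite card_ord; lia.
have ex x : (0 < x <= n./2 - #|m|)%N -> expanding l x (@reach R n x) (@link_length R n x).
  by move=> /andP[x0 xn]; apply: expand; rewrite x0 /=; lia.
have [m' [mm' c' co]] := augment_perfect l0 ex mm cT.
exists m'; split=> //; first by rewrite c' card_ord.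
by apply: le_trans co _; rewrite lerD2l; exact: sum_link_length.
Qed.

(* Completing the empty matching bounds the optimal cost by O(n), while every vertex
   left free at level D costs theta / 2. *)
Lemma unmatched_le m : optimal (lvl D) m ->
  (n./2 - #|m|)%:R * theta <= n%:R * (C1 + 1).
Proof.
move=> opt; have mm : matching m by case/and3P: opt.
have nh : (2 * n./2 = n)%N by rewrite mul2n even_halfK.
have m2 : (#|m| <= n./2)%N.
  by have := card_matching_le mm; rewrite card_ord; lia.
have [m' [mm' c' co]] := complete_matching matching0.
have lo := perfect_cost_lower D mm'.
have Wle := maxW_level_le opt; rewrite -(ler_nat R) natrM in Wle.
have b0 : 0 <= root4 n :> R by exact: root4_ge0.
have hb : mcost l m' <= C1 * n%:R.
  apply: le_trans co _; rewrite /mcost big_set0 add0r cards0 subn0 -mulrA.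
  rewrite ler_wpM2l ?mulr_ge0 //; rewrite -[X in _ <= X]root4E (exprSr _ 3).
  by rewrite ler_wpM2l ?exprn_ge0 // root4_le // -divn2 leq_div.
have m'E : #|m'|%:R = n%:R / 2 :> R by have := congr1 (fun k => k%:R : R) c'; rewrite /= natrM; lra.
have hE : (n./2)%:R = n%:R / 2 :> R by have := congr1 (fun k => k%:R : R) nh; rewrite /= natrM; lra.
rewrite natrB // hE; rewrite m'E in lo.
have nR : 0 <= n%:R :> R by [].
have : dl * ((D%:R - 1) * (n%:R / 2) - D%:R * #|m|%:R) <= C1 * n%:R.
  by apply: le_trans hb; apply: le_trans lo; rewrite ler_wpM2l ?(ltW dl0) // lerD2l lerN2.
have : dl * (n%:R / 2) <= n%:R.
  by have := ler_wpM2r nR dl1; rewrite mul1r => h; lra.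
by rewrite /theta; lra.
Qed.

(** By [unmatched_le] the number k of missing edges is at most (C1 + 1) n / theta, and completion
    costs at most C1 n^(3/4) k^(1/4); the hypothesis on [theta] bounds this by eta n. *)
Lemma perfect_le eta : 0 <= eta -> C1 ^+ 4 * (C1 + 1) <= eta ^+ 4 * theta ->
  exists m, [/\ matching m, (2 * #|m|)%N = n &
    mcost l m <= n%:R * (beta + theta * eps + eta)].
Proof.
move=> eta0 heta; have [m opt] := optimal_ex (lvl D).
have mm : matching m by case/and3P: opt.
have [m' [mm' c' co]] := complete_matching mm; exists m'; split=> //.
have up := optimal_cost_upper opt.
have un := unmatched_le opt.
set k := (n./2 - #|m|)%N in co un.
have theta0 : 0 < theta by rewrite mulr_gt0 // ltr0n.
have C10 : 0 <= C1 by exact: mulr_ge0.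
have b0 : 0 <= root4 n :> R by exact: root4_ge0.
have qk : C1 * root4 k <= eta * root4 n.
  rewrite -(@ler_pXn2r _ 4) ?nnegrE ?mulr_ge0 ?root4_ge0 // [(C1 * _) ^+ 4]exprMn [(eta * _) ^+ 4]exprMn !root4E.
  rewrite -(ler_pM2r theta0) -[leLHS]mulrA.
  apply: le_trans (ler_wpM2l (exprn_ge0 4 C10) un) _.
  by rewrite [leLHS]mulrCA [eta ^+ 4 * _]mulrC -[leRHS]mulrA ler_wpM2l.
have last : C1 * root4 n ^+ 3 * root4 k <= n%:R * eta.
  have -> : C1 * root4 n ^+ 3 * root4 k = root4 n ^+ 3 * (C1 * root4 k) by ring.
  rewrite -[n%:R]root4E (exprSr _ 3) -[leRHS]mulrA [root4 n * eta]mulrC ler_wpM2l // exprn_ge0 //.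
have cm : #|m|%:R <= n%:R / 2 :> R.
  rewrite ler_pdivlMr // -natrM ler_nat mulnC -[leqRHS]card_ord.
  exact: card_matching_le.
have t1 := ler_wpM2l (ltW theta0) cm.
have t2 := ler_wpM2l (ltW dl0) maxW_level_ge_mu.
have t3 : 0 <= n%:R * theta * eps by rewrite !mulr_ge0 // ltW.
apply: le_trans co _; apply: le_trans (lerD up last) _.
by move: t1 t2 t3; rewrite /theta /beta; lra.
Qed.

End Sandwich.
End Assembly.

Lemma perfect_matchingP n (m : {set {set 'I_n}}) :
  perfect_matching n m <-> matching m /\ #|m| = n./2.
Proof.
split=> [[h2 hd hc]|[mm hc]].
  split=> //; apply/andP; split; first by apply/forall_inP => e /h2/eqP.
  by apply/finset.trivIsetP => e f em fm; exact: hd.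
split=> // [e|e f]; first exact: matching_card2.
by have /finset.trivIsetP := matching_triv mm; apply.
Qed.

(** * Measurability of the minimum *)

Section MinMeasurable.
Context {R : realType} {dT} {T : measurableType dT}.

Lemma measurable_big_sum (J : Type) (s : seq J) (A : pred J) (h : J -> T -> R) :
  (forall j, A j -> measurable_fun setT (h j)) ->
  measurable_fun setT (fun w => \sum_(j <- s | A j) h j w).
Proof.
move=> mh; elim: s => [|j s IH].
  by under eq_fun do rewrite big_nil; exact: measurable_cst.
under eq_fun do rewrite big_cons; case: (boolP (A j)) => Aj //.
by apply: measurable_funD => //; exact: mh.
Qed.

(** Over a nonempty index set the infimum is a finite minimum; over an empty one it is the constant
    [inf set0]. *)
Lemma measurable_inf_fin (J : finType) (A : pred J) (h : J -> T -> R) :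
  (forall j, A j -> measurable_fun setT (h j)) ->
  measurable_fun setT (fun w => inf [set c | exists j, A j /\ c = h j w]).
Proof.
move=> mh; case: (pickP A) => [j0 Aj0|noA]; last first.
  rewrite (_ : (fun w => _) = cst (inf set0)); first exact: measurable_cst.
  apply/funext => w; congr inf; apply/seteqP; split=> // c [j []].
  by rewrite noA.
pose g s w := \big[Order.min/h j0 w]_(j <- s | A j) h j w.
have mg s : measurable_fun setT (g s).
  elim: s => [|j s IH]; rewrite /g.
    by under eq_fun do rewrite big_nil; exact: mh.
  under eq_fun do rewrite big_cons; case: (boolP (A j)) => Aj //.
  by apply: measurable_minr => //; exact: mh.
rewrite (_ : (fun w => _) = g (index_enum J)) //; apply/funext => w.
have lb c : (exists j, A j /\ c = h j w) -> g (index_enum J) w <= c.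
  by move=> [j [Aj ->]]; apply: bigmin_le_cond.
apply/eqP; rewrite eq_le; apply/andP; split; last first.
  apply: lb_le_inf; first by exists (h j0 w), j0.
  by move=> c; exact: lb.
have ge j : A j -> inf [set c | exists j, A j /\ c = h j w] <= h j w.
  by move=> Aj; apply: ge_inf; [exists (g (index_enum J) w) => c; exact: lb|exists j].
by rewrite /g; apply/bigmin_geP; split=> [|j Aj]; exact: ge.
Qed.

Lemma min_matching_meas (d : R) n (X : 'I_n -> 'I_n -> T -> R) :
  (forall i j : 'I_n, (i < j)%N -> measurable_fun setT (X i j)) ->
  measurable_fun setT (fun w => min_matching d n (fun i j => X i j w)).
Proof.
move=> Xm; pose A (m : {set {set 'I_n}}) := matching m && (#|m| == n./2).
pose h m w := mcost (len d X w) m.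
rewrite (_ : (fun w => _) = (fun w => inf [set c | exists m, A m /\ c = h m w])).
  apply: measurable_inf_fin => m /andP[mm _]; apply: measurable_big_sum => e em.
  have [i <-] := endsP (matching_card2 mm em).
  under eq_fun do rewrite len_ends.
  by apply: measurableT_comp; [exact: edge_length_meas|exact: xi_meas].
apply/funext => w; congr inf; apply/seteqP; split=> c /= [m [pm ->]]; exists m; split=> //.
  by have /perfect_matchingP[mm mE] := pm; rewrite /A mm mE eqxx.
by apply/perfect_matchingP; case/andP: pm => mm /eqP.
Qed.

End MinMeasurable.

(** * Approximate limits and convergence in probability *)

Section Approximation.
Context {R : realType}.
Variable d : R.
Hypothesis d1 : 1 <= d.

(** [beta] and [C] are chosen before the probability space, which makes the limit depend on [d]
    alone. *)
Lemma min_matching_approx (e : R) : 0 < e -> exists beta C : R, 0 <= C /\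
  forall dT (T : measurableType dT) (P : probability T R) n (X : 'I_n -> 'I_n -> T -> R),
    (256 <= n)%N -> ~~ odd n -> iid_model P X ->
    exists bad : set T, [/\ measurable bad, (P bad <= (C / n%:R)%:E)%E &
      forall w, ~ bad w ->
        `|min_matching d n (fun i j => X i j w) / n%:R - beta| <= e].
Proof.
move=> e0; pose C1 : R := 12 * link_const; pose eta := e / 2.
have eta0 : 0 < eta by rewrite divr_gt0.
have C10 : 0 <= C1 by exact: mulr_ge0.
(* The cutoff comes first, as required by [perfect_le]; the mesh and [eps] may then depend on it. *)
pose theta := C1 ^+ 4 * (C1 + 1) / eta ^+ 4 + 1.
have theta0 : 0 < theta.
  have pos (a : R) : 0 <= a -> 0 < a ^+ 4 * (a + 1) / eta ^+ 4 + 1.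
    move=> a0; apply: ltr_wpDl => //; apply: divr_ge0.
      by apply: mulr_ge0; [exact: exprn_ge0|exact: addr_ge0].
    by apply: exprn_ge0; exact: ltW.
  exact: pos C10.
pose p := powR theta d; have p0 : 0 <= p by exact: powR_ge0.
(* [u] combines both demands on the mesh: dl u <= 1 yields dl <= 1 and dl (1 + theta^d) <= e / 2. *)
pose u := 1 + 2 * (1 + p) / e.
have u1 : 1 <= u by rewrite lerDl divr_ge0 ?mulr_ge0 ?addr_ge0 // ltW.
pose D := Num.bound (theta * u).
have Du : theta * u < D%:R by apply: archi_boundP; rewrite mulr_ge0 ?(ltW theta0) // (le_trans _ u1).
have DR : 0 < D%:R :> R by apply: le_lt_trans Du; rewrite mulr_ge0 ?(ltW theta0) // (le_trans _ u1).
have D0 : (0 < D)%N by rewrite -(ltr0n R).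
pose dl := theta / D%:R; have dl0 : 0 < dl by rewrite divr_gt0.
have dlu : dl * u <= 1.
  by rewrite /dl mulrAC ler_pdivrMr // mul1r ltW.
have dl1 : dl <= 1 by apply: le_trans dlu; rewrite ler_peMr // ltW.
have dlp : dl * (1 + p) <= eta.
  have h : dl * (2 * (1 + p) / e) <= 1.
    by apply: le_trans dlu; rewrite ler_wpM2l ?(ltW dl0) // /u lerDr.
  have -> : dl * (1 + p) = dl * (2 * (1 + p) / e) * eta by rewrite /eta; field; rewrite gt_eqF.
  by rewrite ler_piMl // ltW.
have Ddl : D%:R * dl = theta by rewrite /dl mulrC divfK // gt_eqF.
pose eps := eta / theta; have eps0 : 0 < eps by rewrite divr_gt0.
have teps : theta * eps = eta by rewrite /eps mulrC divfK // gt_eqF.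
have [mu hmu] := choice (fun t => level_event t d1 dl0 eps0).
have [C hC] := choice hmu.
exists (dl * (D%:R - \sum_(t < D) mu t) / 2), (512 + \sum_(t < D.+1) C t); split.
  by rewrite addr_ge0 ?ler0n // sumr_ge0 // => t _; have [] := hC t.
move=> dT T P n X n256 n_even model; have [Xm Xl Xi] := model.
have n0 : (0 < n)%N by apply: leq_trans n256.
have nR : 0 < n%:R :> R by rewrite ltr0n.
have [badE [mE PE hE]] := expansion_event d1 n0 Xm Xl Xi n256.
have bt t := let: And3 _ _ h := hC t in h dT T P n X n0 model.
have [bad hbad] := choice bt.
exists (badE `|` \big[setU/set0]_(t < D.+1) bad t); split.
- by apply: measurableU => //; apply: bigsetU_measurable => t _; have [] := hbad t.
- have mb : measurable (\big[setU/set0]_(t < D.+1) bad t).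
    by apply: bigsetU_measurable => t _; have [] := hbad t.
  apply: le_trans (measureU2 _ mE mb) _.
  rewrite mulrDl EFinD; apply: leeD => //.
  apply: le_trans (measure_bigsetU_le P _ _) _; first by move=> t _; have [] := hbad t.
  by rewrite mulr_suml -sumEFin; apply: lee_sum => t _; have [] := hbad t.
move=> w nbad.
have nE : ~ badE w by move=> h; apply: nbad; left.
have nt t : (t <= D)%N -> ~ bad t w.
  move=> tD h; apply: nbad; right; apply/bigsetUP.
  by exists (Ordinal (tD : (t < D.+1)%N)); split => //; exact: mem_index_enum.
have near t m : (t <= D)%N -> optimal (lvl (len d X w) dl t) m ->
  n%:R * (mu t - eps) <= (2 * #|m|)%:R <=
  n%:R * (mu t + 2 * (glev dl d t 0 - glev dl d t 1) + 2 * eps).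
  by move=> tD; have [_ _] := hbad t; apply; exact: nt.
have mu_itv t : 0 <= mu t <= 1 by have [] := hC t.
have l0 := len_ge0 d X w.
have lower m : matching m -> (2 * #|m|)%N = n -> n%:R * (dl * (D%:R - \sum_(t < D) mu t) / 2 - e)
    <= mcost (len d X w) m.
  move=> mm m2; apply: le_trans (perfect_ge l0 dl0 D0 mu_itv near mm m2).
  rewrite ler_wpM2l ?(ltW nR) // Ddl teps -/p.
  by move: dlp; rewrite /eta; lra.
have [|m0 [mm0 c0 up]] := perfect_le l0 dl0 d1 eps0 D0 n0 near dl1 n_even (hE w nE) (ltW eta0).
  have gen (a b : R) : 0 < b -> a <= b * (a / b + 1).
    by move=> b0; rewrite mulrDr mulr1 mulrCA divff ?gt_eqF // mulr1 lerDl ltW.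
  by rewrite Ddl; apply: gen; exact: exprn_gt0.
rewrite Ddl teps in up.
set beta := dl * _ / 2 in lower up *.
have nh : (2 * n./2)%N = n by rewrite mul2n even_halfK.
have pm m : perfect_matching n m -> matching m /\ (2 * #|m|)%N = n.
  by move=> /perfect_matchingP[mm ->].
have lb c : (exists m, perfect_matching n m /\
    c = matching_cost d n (fun i j => X i j w) m) -> n%:R * (beta - e) <= c.
  by move=> [m [/pm[mm m2] ->]]; exact: lower.
have pm0 : perfect_matching n m0.
  by apply/perfect_matchingP; split=> //; rewrite -[in RHS]c0 mul2n doubleK.
rewrite ler_distl ler_pdivlMr // ler_pdivrMr //; apply/andP; split.
  rewrite mulrC; apply: lb_le_inf; last by move=> c; exact: lb.
  by exists (matching_cost d n (fun i j => X i j w) m0), m0.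
apply: (@le_trans _ _ (mcost (len d X w) m0)).
  by apply: ge_inf; [exists (n%:R * (beta - e)) => c; exact: lb|exists m0].
apply: le_trans up _; rewrite mulrC ler_wpM2r ?(ltW nR) //.
by rewrite /eta; lra.
Qed.

End Approximation.

Lemma not_in_two_bad (R : realType) dT (T : measurableType dT) (P : probability T R)
    (A B : set T) (a b : R) : measurable A -> measurable B ->
  (P A <= a%:E)%E -> (P B <= b%:E)%E -> a + b < 1 -> exists w, ~ A w /\ ~ B w.
Proof.
move=> mA mB PA PB ab; apply: contrapT => no.
have AB : A `|` B = setT.
  apply/seteqP; split=> // w _; apply: contrapT => nw; apply: no; exists w.
  by split=> h; apply: nw; [left|right].
have h : (P (A `|` B) <= P A + P B)%E by exact: measureU2.
rewrite AB probability_setT in h.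
have : (1 <= (a + b)%:E :> \bar R)%E by rewrite EFinD; apply: le_trans h _; exact: leeD.
by rewrite lee_fin leNgt ab.
Qed.

(** Pairwise intersecting intervals have a common point: the supremum of the left endpoints. *)
Lemma common_approximation (R : realType) (b e : nat -> R) :
  (forall i j, b i - e i <= b j + e j) -> exists beta, forall i, `|beta - b i| <= e i.
Proof.
move=> h; pose S := [set x | exists i, x = b i - e i].
have S0 : S !=set0 by exists (b 0%N - e 0%N), 0%N.
have ubS j : ubound S (b j + e j) by move=> x [i ->].
exists (sup S) => i; rewrite ler_distl; apply/andP; split.
  by apply: ub_le_sup; [exists (b 0%N + e 0%N); exact: ubS|exists i].
exact: ge_sup.
Qed.

Theorem theorem1 (R : realType) (d : R) (hd : 1 <= d) :
  exists beta : R,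
  forall (dT : measure_display) (T : measurableType dT) (P : probability T R)
    (X : forall n : nat, 'I_n -> 'I_n -> T -> R),
    (forall n (i j : 'I_n), (i < j)%N -> measurable_fun setT (X n i j)) ->
    (forall n (i j : 'I_n), (i < j)%N ->
       forall B : set R, measurable B ->
         P (X n i j @^-1` B) = exponential_prob 1 B) ->
    (forall n, mutually_independent P
       (fun e : edge_index n => X n (sval e).1 (sval e).2)) ->
    forall eps : R, 0 < eps ->
      (fun k : nat =>
         P [set w | eps < `| min_matching d k.*2 (fun i j => X k.*2 i j w) / (k.*2)%:R
                              - beta |])
      @ \oo --> 0%E.
Proof.
pose e i : R := i.+1%:R^-1.
have e0 i : 0 < e i by rewrite invr_gt0.
have [b hb] := choice (fun i => min_matching_approx hd (e0 i)).
have [C hC] := choice hb.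
(* Without a model the statement is vacuous, but then nothing relates the b i. *)
case: (pselect (exists dT (T : measurableType dT) (P : probability T R)
    (X : forall n : nat, 'I_n -> 'I_n -> T -> R), forall n, iid_model P (X n))); last first.
  move=> no; exists 0 => dT T P X Xm Xl Xi; exfalso; apply: no.
  by exists dT, T, P, X => n; split; [exact: Xm|exact: Xl|exact: Xi].
move=> [dT [T [P [X model]]]].
(* For n large the two bad events do not cover the space, and at a sample point outside both, the
   same ratio lies in both intervals. *)
have compat i j : b i - e i <= b j + e j.
  have [Ci0 hi] := hC i; have [Cj0 hj] := hC j.
  pose k := (Num.bound (C i + C j) + 256)%N.
  have k2 : (256 <= k.*2)%N by rewrite -addnn; apply: leq_trans (leq_addr _ _); rewrite leq_addl.
  have [A [mA PA hA]] := hi _ _ P _ (X k.*2) k2 (negbT (odd_double k)) (model _).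
  have [B [mB PB hB]] := hj _ _ P _ (X k.*2) k2 (negbT (odd_double k)) (model _).
  have [|w [nA nB]] := not_in_two_bad mA mB PA PB.
    rewrite -mulrDl ltr_pdivrMr ?ltr0n ?(leq_trans _ k2) // mul1r.
    apply: lt_le_trans (archi_boundP (addr_ge0 Ci0 Cj0)) _.
    by rewrite ler_nat -addnn; apply: leq_trans (leq_addr _ _); rewrite leq_addr.
  have := hA w nA; have := hB w nB; rewrite !ler_distl.
  by move=> /andP[_ h1] /andP[h2 _]; lra.
have [beta hbeta] := common_approximation compat.
exists beta => {dT T P X model} dT T P X Xm Xl Xi eps eps0.
(* One [e i] is for the ratio against [b i], the other for [b i] against [beta]. *)
pose i := Num.bound (2 / eps).
have ei : 2 * e i <= eps.
  have h : 2 / eps < i%:R by apply: archi_boundP; rewrite divr_ge0 // ltW.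
  rewrite /e ler_pdivrMr // -ler_pdivrMl // mulrC.
  by apply: le_trans (ltW h) _; rewrite ler_nat.
have [C0 hi] := hC i.
apply: (@squeeze_cvge _ _ _ _ (cst 0%E) _ (fun k => (C i * @harmonic R k)%:E)).
- near=> k; apply/andP; split; first exact: measure_ge0.
  have k256 : (256 <= k)%N by near: k; exact: nbhs_infty_ge.
  have k2 : (256 <= k.*2)%N by rewrite -addnn (leq_trans k256) // leq_addr.
  have model : iid_model P (X k.*2) by split; [exact: Xm|exact: Xl|exact: Xi].
  have [A [mA PA hA]] := hi _ _ P _ (X k.*2) k2 (negbT (odd_double k)) model.
  set f := fun w => `|min_matching d k.*2 (fun i j => X k.*2 i j w) / k.*2%:R - beta|.
  have mE : measurable [set w | eps < f w].
    have mf : measurable_fun setT f.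
      apply: measurableT_comp => //; apply: measurable_funB => //.
      by apply: measurable_funM => //; apply: min_matching_meas; exact: Xm.
    have -> : [set w | eps < f w] = ~` [set w | f w <= eps].
      by apply/seteqP; split=> w /=; rewrite ltNge => /negP.
    apply: measurableC; rewrite -[X in measurable X]setTI.
    by apply: (measurable_fun_le (g := cst eps)).
  have le_PA : (P [set w | (eps < f w)%R] <= P A)%E.
    rewrite le_measure ?inE // => w /= hw; apply: contrapT => nA; have h1 := hA w nA; have h2 := hbeta i.
    move: h1 h2 hw; rewrite ltNge => h1 h2 /negP; apply.
    apply: le_trans ei; rewrite /f -[min_matching _ _ _ / _](subrK (b i)) -addrA.
    apply: le_trans (ler_normD _ _) _; rewrite mulr2n mulrDl mul1r lerD //.
    by rewrite distrC.
  apply: (le_trans le_PA); apply: (le_trans PA); rewrite lee_fin ler_wpM2l // lef_pV2 ?posrE ?ltr0n //.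
    by rewrite ler_nat -addnn; lia.
  by rewrite (leq_trans _ k2).
- exact: cvg_cst.
- apply: cvg_EFin; first by near=> k.
  rewrite -[X in _ --> X](mulr0 (C i)).
  by apply: cvgM; [exact: cvg_cst|exact: cvg_harmonic].
Unshelve. all: by end_near.
Qed.
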